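(* Let $\mathcal{P}=He_1\oplus He_2$ be the free left $H$-module of rank two with basis $e_1,e_2$, equipped with an $H$-pseudoalgebra structure such that $$e_{1}\ast e_{1}=0, \quad e_{2}\ast e_{2}=t\otimes1 \otimes_{H}e_{2}$$ for some nonzero $t\in\mathbf{k}$ (and $e_1\ast e_2$, $e_2\ast e_1$ are arbitrary elements of $(H\otimes H)\otimes_H\mathcal{P}$). Then $\mathcal{P}$ is a left pre-Lie $H$-pseudoalgebra if and only if it is of the following type: $$e_{1}\ast e_{2}=\alpha\otimes_{H}e_{1}, \quad e_{2}\ast e_{1}=g\otimes1\otimes_{H}e_{1},$$ where $\alpha=0$ or $\alpha=t$, and $g\in H$ is arbitrary.
   Context: $\mathbf{k}$ is an algebraically closed field of characteristic $0$, $\delta$ is a finite-dimensional Lie algebra over $\mathbf{k}$, and $H=U(\delta)$ is its universal enveloping algebra with the standard cocommutative Hopf structure ($\Delta(x)=x\otimes1+1\otimes x$ for $x\in\delta$). We regard $\mathbf{k},\delta\subset H$. $H^{\otimes n}$ is a right $H$-module via the iterated coproduct, e.g. $(f\otimes g)\cdot h=(f\otimes g)\Delta(h)$. An $H$-pseudoalgebra is a left $H$-module $A$ with a map $\ast:A\otimes A\to(H\otimes H)\otimes_H A$ that is $H$-bilinear: $hx\ast gy=(h\otimes g\otimes_H1)(x\ast y)$ for $x,y\in A$, $h,g\in H$. For $\beta\in H\otimes H$ and $x\ast y=\sum_i\alpha_i\otimes_Hc_i$ one sets, in $H^{\otimes3}\otimes_HA$, $(\beta\otimes_Hx)\ast y=\sum_i(\beta\otimes1)(\Delta\otimes\mathrm{id})(\alpha_i)\otimes_Hc_i$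 and $x\ast(\beta\otimes_Hy)=\sum_i(1\otimes\beta)(\mathrm{id}\otimes\Delta)(\alpha_i)\otimes_Hc_i$. $A$ is left pre-Lie if for all $x,y,z\in A$ $$(x\ast y)\ast z-x\ast(y\ast z)=((12)\otimes_H\mathrm{id})[(y\ast x)\ast z-y\ast(x\ast z)],$$ where $(12)(f\otimes h\otimes g)=h\otimes f\otimes g$. Conventions: a scalar $c\in\mathbf{k}$ appearing as an element of $H\otimes H$ means $c(1\otimes1)$; $f\otimes g\otimes_He$ means $(f\otimes g)\otimes_He$. By $H$-bilinearity a pseudoproduct on a free module is determined by its values on basis elements. *)

(* Defs.v *)
From HB Require Import structures.
From mathcomp Require Import all_boot all_order all_algebra.
From mathcomp Require Import boolp classical_sets.

Set Implicit Arguments.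
Unset Strict Implicit.
Unset Printing Implicit Defensive.

Import GRing.Theory.
Local Open Scope ring_scope.
Local Open Scope quotient_scope.

HB.mixin Record Lmodule_isLieAlgebra (k : fieldType) L of GRing.Lmodule k L := {
  lieb : L -> L -> L;
  lieb_linearl : forall y, linear (lieb^~ y);
  lieb_linearr : forall x, linear (lieb x);
  lieb_alt : forall x, lieb x x = 0;
  lieb_jacobi : forall x y z,
    lieb x (lieb y z) + lieb y (lieb z x) + lieb z (lieb x y) = 0
}.

#[short(type="lieAlgType")]
HB.structure Definition LieAlgebra (k : fieldType) :=
  {L of Lmodule_isLieAlgebra k L & GRing.Lmodule k L}.

#[short(type="fdLieAlgType")]
HB.structure Definition FdLieAlgebra (k : fieldType) :=
  {L of Lmodule_isLieAlgebra k L & Vector k L}.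

Section QuotientByEquivalence.
Variables (T : choiceType) (e : T -> T -> Prop).
Hypotheses (er : forall x, e x x) (es : forall x y, e x y -> e y x).
Hypothesis (et : forall y x z, e x y -> e y z -> e x z).

Lemma asbool_equiv : equiv_class_of (fun x y => `[< e x y >]).
Proof.
split=> [x|x y|y x z]; first exact/asboolP.
- by apply/asboolP/asboolP; apply: es.
- by move=> /asboolP xy /asboolP yz; apply/asboolP; apply: et xy yz.
Qed.
Definition asbool_equiv_rel := EquivRelPack asbool_equiv.

Lemma pi_asboolP x y :
  (\pi_({eq_quot asbool_equiv_rel}) x = \pi_({eq_quot asbool_equiv_rel}) y)
  <-> e x y.
Proof. by split=> [/eqmodP /asboolP|xy] //; apply/eqmodP/asboolP. Qed.
End QuotientByEquivalence.

(* The tensor product over S of abelian groups M and N on which S acts on the *)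
(* right, resp. on the left: the abelian group presented by the generators    *)
(* m ⊗ n, subject to biadditivity and (m s) ⊗ n = m ⊗ (s n).                  *)
Section BalancedTensor.
Variables (S : Type) (M N : zmodType) (ract : M -> S -> M) (lact : S -> N -> N).

Inductive btterm :=
| BtPure of M & N | BtZero | BtOpp of btterm | BtAdd of btterm & btterm.

Inductive bteq : btterm -> btterm -> Prop :=
| bteq_refl x : bteq x x
| bteq_sym x y : bteq x y -> bteq y x
| bteq_trans y x z : bteq x y -> bteq y z -> bteq x z
| bteq_opp x x' : bteq x x' -> bteq (BtOpp x) (BtOpp x')
| bteq_add x x' y y' :
    bteq x x' -> bteq y y' -> bteq (BtAdd x y) (BtAdd x' y')
| bteq_addA x y z : bteq (BtAdd x (BtAdd y z)) (BtAdd (BtAdd x y) z)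
| bteq_addC x y : bteq (BtAdd x y) (BtAdd y x)
| bteq_add0 x : bteq (BtAdd BtZero x) x
| bteq_addN x : bteq (BtAdd (BtOpp x) x) BtZero
| bteq_pureDl m m' n :
    bteq (BtPure (m + m') n) (BtAdd (BtPure m n) (BtPure m' n))
| bteq_pureDr m n n' :
    bteq (BtPure m (n + n')) (BtAdd (BtPure m n) (BtPure m n'))
| bteq_bal m s n : bteq (BtPure (ract m s) n) (BtPure m (lact s n)).

HB.instance Definition _ := gen_eqMixin btterm.
HB.instance Definition _ := gen_choiceMixin btterm.

Definition bt_equiv := asbool_equiv_rel bteq_refl bteq_sym bteq_trans.
Definition btens := {eq_quot bt_equiv}.
HB.instance Definition _ := Choice.on btens.
HB.instance Definition _ := Quotient.on btens.

Lemma btensP x y : (\pi_btens x = \pi_btens y) <-> bteq x y.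
Proof. exact: pi_asboolP. Qed.

Lemma btens_repr x : bteq (repr (\pi_btens x)) x.
Proof. by apply/btensP; rewrite reprK. Qed.

Definition bpure (m : M) (n : N) : btens := \pi_btens (BtPure m n).
Definition btens_zero : btens := \pi_btens BtZero.
Definition btens_opp (x : btens) : btens := \pi_btens (BtOpp (repr x)).
Definition btens_add (x y : btens) : btens := \pi_btens (BtAdd (repr x) (repr y)).

Lemma btens_oppE x : btens_opp (\pi_btens x) = \pi_btens (BtOpp x).
Proof. by apply/btensP; apply: bteq_opp; apply: btens_repr. Qed.

Lemma btens_addE x y : btens_add (\pi_btens x) (\pi_btens y) = \pi_btens (BtAdd x y).
Proof. by apply/btensP; apply: bteq_add; apply: btens_repr. Qed.

Lemma btens_addA : associative btens_add.
Proof.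
elim/quotW=> x; elim/quotW=> y; elim/quotW=> z.
rewrite (btens_addE y z) (btens_addE x y) !btens_addE.
by apply/btensP; apply: bteq_addA.
Qed.

Lemma btens_addC : commutative btens_add.
Proof.
elim/quotW=> x; elim/quotW=> y.
by rewrite !btens_addE; apply/btensP; apply: bteq_addC.
Qed.

Lemma btens_add0 : left_id btens_zero btens_add.
Proof. by elim/quotW=> x; rewrite btens_addE; apply/btensP; apply: bteq_add0. Qed.

Lemma btens_addN : left_inverse btens_zero btens_opp btens_add.
Proof.
by elim/quotW=> x; rewrite btens_oppE btens_addE; apply/btensP; apply: bteq_addN.
Qed.

HB.instance Definition _ := GRing.isZmodule.Build btens
  btens_addA btens_addC btens_add0 btens_addN.

Lemma bpureDl m m' n : bpure (m + m') n = bpure m n + bpure m' n.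
Proof. by rewrite [RHS]btens_addE; apply/btensP; apply: bteq_pureDl. Qed.

Lemma bpureDr m n n' : bpure m (n + n') = bpure m n + bpure m n'.
Proof. by rewrite [RHS]btens_addE; apply/btensP; apply: bteq_pureDr. Qed.

Lemma bpure_bal m s n : bpure (ract m s) n = bpure m (lact s n).
Proof. by apply/btensP; apply: bteq_bal. Qed.

Lemma btens_ind (Q : btens -> Prop) :
  (forall m n, Q (bpure m n)) -> Q 0 -> (forall x, Q x -> Q (- x)) ->
  (forall x y, Q x -> Q y -> Q (x + y)) -> forall x, Q x.
Proof.
move=> Qp Q0 QN QD; elim/quotW; elim=> [m n||x Qx|x Qx y Qy]; first exact: Qp.
- exact: Q0.
- by rewrite -[\pi_btens _]btens_oppE; apply: QN.
- by rewrite -[\pi_btens _]btens_addE; apply: QD.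
Qed.

Section Lift.
Variables (V : zmodType) (f : M -> N -> V).

Definition balanced :=
  [/\ forall m m' n, f (m + m') n = f m n + f m' n,
      forall m n n', f m (n + n') = f m n + f m n'
    & forall m s n, f (ract m s) n = f m (lact s n)].

Fixpoint bteval (x : btterm) : V :=
  match x with
  | BtPure m n => f m n
  | BtZero => 0
  | BtOpp x => - bteval x
  | BtAdd x y => bteval x + bteval y
  end.

(* The additive map m ⊗ n |-> f m n; meaningful when f is balanced. *)
Definition blift (x : btens) : V := bteval (repr x).

Hypothesis fbal : balanced.

Lemma bteval_eq x y : bteq x y -> bteval x = bteval y.
Proof.
case: fbal => fDl fDr fb.
elim=> //= {x y}.
- by move=> y x z _ -> _ ->.
- by move=> x y _ ->.
- by move=> x x' y y' _ -> _ ->.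
- by move=> x y z; rewrite addrA.
- by move=> x y; rewrite addrC.
- by move=> x; rewrite add0r.
- by move=> x; rewrite addNr.
Qed.

Lemma blift_pi x : blift (\pi_btens x) = bteval x.
Proof. by apply: bteval_eq; apply: btens_repr. Qed.

Lemma blift_pure m n : blift (bpure m n) = f m n.
Proof. exact: blift_pi. Qed.

Lemma bliftD x y : blift (x + y) = blift x + blift y.
Proof.
move: x y; elim/quotW=> x; elim/quotW=> y.
by rewrite [_ + _]btens_addE !blift_pi.
Qed.

Lemma blift0 : blift 0 = 0.
Proof. by rewrite [0 in LHS]/GRing.zero /= blift_pi. Qed.

Lemma bliftN x : blift (- x) = - blift x.
Proof. by apply/eqP; rewrite -addr_eq0 -bliftD addNr blift0. Qed.

End Lift.

Lemma btens_ext (V : zmodType) (F G : btens -> V) :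
  {morph F : x y / x + y} -> {morph G : x y / x + y} ->
  (forall m n, F (bpure m n) = G (bpure m n)) -> F =1 G.
Proof.
move=> FD GD FG.
have add0 (E : btens -> V) : {morph E : x y / x + y} -> E 0 = 0.
  by move=> ED; apply/(addrI (E 0)); rewrite -ED !addr0.
have addN (E : btens -> V) : {morph E : x y / x + y} -> {morph E : x / - x}.
  by move=> ED x; apply/eqP; rewrite -addr_eq0 -ED addNr add0.
elim/btens_ind=> [//||x IH|x y IHx IHy].
- by rewrite !add0.
- by rewrite !addN // IH.
- by rewrite FD GD IHx IHy.
Qed.

End BalancedTensor.

Section TensorOfModules.
Variables (k : fieldType) (A B : lmodType k).
Definition tens : Type :=
  btens (fun (a : A) (c : k) => c *: a) (fun (c : k) (b : B) => c *: b).
HB.instance Definition _ := GRing.Zmodule.on tens.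
Definition tpure (a : A) (b : B) : tens := bpure _ _ a b.

Lemma tpureDl a a' b : tpure (a + a') b = tpure a b + tpure a' b.
Proof. exact: bpureDl. Qed.
Lemma tpureDr a b b' : tpure a (b + b') = tpure a b + tpure a b'.
Proof. exact: bpureDr. Qed.
Lemma tpureZ c a b : tpure (c *: a) b = tpure a (c *: b).
Proof. exact: bpure_bal. Qed.

Definition tens_scale (c : k) : tens -> tens :=
  blift (fun a b => tpure (c *: a) b).

Lemma tens_scale_bal c : balanced (fun (a : A) (c : k) => c *: a)
  (fun (c : k) (b : B) => c *: b) (fun a b => tpure (c *: a) b).
Proof.
split=> [a a' b|a b b'|a d b].
- by rewrite scalerDr tpureDl.
- by rewrite tpureDr.
- by rewrite scalerA mulrC -scalerA tpureZ.
Qed.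

Lemma tens_scaleE c a b : tens_scale c (tpure a b) = tpure (c *: a) b.
Proof. exact: (blift_pure (tens_scale_bal c)). Qed.

Lemma tens_scaleD c : {morph tens_scale c : x y / x + y}.
Proof. by move=> x y; apply: (bliftD (tens_scale_bal c)). Qed.

Lemma tens_scaleA a b v : tens_scale a (tens_scale b v) = tens_scale (a * b) v.
Proof.
move: v; apply: btens_ext=> [x y|x y|m n]; rewrite ?tens_scaleD //.
by rewrite -/(tpure m n) !tens_scaleE scalerA.
Qed.

Lemma tens_scale1 : left_id 1 tens_scale.
Proof.
apply: btens_ext=> [x y|x y|m n]; rewrite ?tens_scaleD //.
by rewrite -/(tpure m n) !tens_scaleE scale1r.
Qed.

Lemma tens_scaleDl v : {morph tens_scale^~ v : a b / a + b}.
Proof.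
move=> a b /=; move: v; apply: btens_ext=> [x y|x y|m n].
- by rewrite ?tens_scaleD.
- by rewrite !tens_scaleD addrACA.
- by rewrite -/(tpure m n) !tens_scaleE scalerDl tpureDl.
Qed.

HB.instance Definition _ := GRing.Zmodule_isLmodule.Build k tens
  tens_scaleA tens_scale1 tens_scaleD tens_scaleDl.

Lemma tens_scalel c a b : c *: tpure a b = tpure (c *: a) b.
Proof. exact: tens_scaleE. Qed.

Lemma tens_scaler c a b : c *: tpure a b = tpure a (c *: b).
Proof. by rewrite tens_scalel tpureZ. Qed.

Lemma tens_ind (Q : tens -> Prop) :
  (forall a b, Q (tpure a b)) -> (forall x y, Q x -> Q y -> Q (x + y)) ->
  forall x, Q x.
Proof.
move=> Qp QD; elim/btens_ind=> [//||x Qx|//].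
- have -> : 0 = tpure 0 0 by rewrite -(scale0r (0 : A)) -tens_scalel scale0r.
  exact: Qp.
- have {Qx}: forall c, Q (c *: (x : tens)).
    move: x {Qx}; elim/btens_ind=> [a b||x IH|x y IHx IHy] c.
    + by rewrite -/(tpure a b) tens_scalel; apply: Qp.
    + have -> : c *: (0 : tens) = tpure 0 0.
        by rewrite -(scale0r (0 : A)) -tens_scalel scale0r scaler0.
      exact: Qp.
    + by rewrite scalerN -scaleNr; apply: IH.
    + by rewrite scalerDr; apply: QD.
  by move=> /(_ (-1)); rewrite scaleN1r.
Qed.

End TensorOfModules.

Notation "a ⊗ b" := (tpure a b) (at level 40, left associativity) : ring_scope.

Section TensorLift.
Variables (k : fieldType) (A B : lmodType k) (V : zmodType) (f : A -> B -> V).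

Definition tlift : tens A B -> V := blift f.

Definition kbalanced :=
  balanced (fun (a : A) (c : k) => c *: a) (fun (c : k) (b : B) => c *: b) f.

Hypothesis fbal : kbalanced.
Lemma tlift_pure a b : tlift (a ⊗ b) = f a b.
Proof. exact: (blift_pure fbal). Qed.
Lemma tliftD : {morph tlift : x y / x + y}.
Proof. by move=> x y; apply: (bliftD fbal). Qed.
End TensorLift.

(* Over a field, 1 ⊗ 1 <> 0; this makes a tensor product of algTypes an algType. *)
Lemma unit_functional (k : fieldType) (A : algType k) :
  exists phi : A -> k,
    (forall c x y, phi (c *: x + y) = c * phi x + phi y) /\ phi 1 = 1.
Proof.
pose P (W : set A) := (forall c x y, W x -> W y -> W (c *: x + y)) /\ ~ W 1.
have [|W [[WL W1] Wmax]] := @Zorn_bigcup A P.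
  move=> F FP Ftot; split=> [c x y [X FX Xx] [Y FY Yy]|[X FX X1]]; last first.
    by case: (FP _ FX).
  case: (Ftot _ _ FX FY) => XY.
  - by exists Y => //; apply: (FP _ FY).1 => //; apply: XY.
  - by exists X => //; apply: (FP _ FX).1 => //; apply: XY.
have W0 : W 0.
  apply: contrapT => W0; apply: (Wmax [set 0]%classic); last first.
    split=> [c x y /= -> ->|/= /eqP]; first by rewrite scaler0 addr0.
    by rewrite oner_eq0.
  split=> [|/(_ 0 erefl)//] x Wx; exfalso; apply: W0.
  by have := WL (-1) x x Wx Wx; rewrite scaleN1r addNr.
have WZ c x : W x -> W (c *: x) by move=> Wx; rewrite -[_ *: _]addr0; apply: WL.
have WD x y : W x -> W y -> W (x + y).
  by move=> Wx Wy; rewrite -[x]scale1r; apply: WL.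
have Wsum x : exists c : k, W (x - c *: 1).
  case: (pselect (W x)) => [Wx|nWx]; first by exists 0; rewrite scale0r subr0.
  have : ~ P [set y | exists c, W (y - c *: x)]%classic.
    apply: Wmax; split=> [y Wy|/(_ x) Wx]; first by exists 0; rewrite scale0r subr0.
    by apply/nWx/Wx; exists 1; rewrite scale1r subrr.
  case/not_andP=> [[]|/contrapT /= [c]].
    move=> c y z [d Wy] [e Wz]; exists (c * d + e).
    have := WL c _ _ Wy Wz.
    by rewrite scalerBr scalerA addrACA -opprD -scalerDl.
  have [->|c0] := eqVneq c 0; first by rewrite scale0r subr0.
  move=> Wc; exists c^-1; have := WZ (- c^-1) _ Wc.
  by rewrite scalerBr scalerA mulNr mulVf // scaleN1r opprK addrC scaleNr.
have Wu x c d : W (x - c *: 1) -> W (x - d *: 1) -> c = d.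
  move=> Wc Wd; apply/eqP; rewrite -subr_eq0; apply/negP=> /negP cd0; apply: W1.
  have := WL (-1) _ _ Wc Wd; rewrite scaleN1r opprB addrA subrK.
  rewrite -scalerBl => /(WZ (c - d)^-1).
  by rewrite scalerA mulVf // scale1r.
have [phi phiP] := choice Wsum; exists phi; split=> [c x y|].
  apply: (Wu (c *: x + y)) => //.
  have := WL c _ _ (phiP x) (phiP y).
  by rewrite scalerBr scalerA addrACA -opprD -scalerDl.
by apply: (Wu 1) => //; rewrite scale1r subrr.
Qed.

Section TensorOfAlgebras.
Variables (k : fieldType) (A B : algType k).

Definition tens_one : tens A B := 1 ⊗ 1.
(* (a ⊗ b) (c ⊗ d) = ac ⊗ bd *)
Definition tens_lmul (a : A) (b : B) : tens A B -> tens A B :=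
  tlift (fun c d => (a * c) ⊗ (b * d)).
Definition tens_mul (x y : tens A B) : tens A B :=
  tlift (fun a b => tens_lmul a b y) x.

Lemma tens_lmul_bal a b :
  kbalanced (fun (c : A) (d : B) => (a * c) ⊗ (b * d)).
Proof.
split=> [c c' d|c d d'|c s d].
- by rewrite mulrDr tpureDl.
- by rewrite mulrDr tpureDr.
- by rewrite -!scalerAr tpureZ.
Qed.

Lemma tens_lmulE a b c d : tens_lmul a b (c ⊗ d) = (a * c) ⊗ (b * d).
Proof. exact: (tlift_pure (tens_lmul_bal a b)). Qed.

Lemma tens_lmulD a b : {morph tens_lmul a b : x y / x + y}.
Proof. exact: (tliftD (tens_lmul_bal a b)). Qed.

Lemma tens_mul_bal y : kbalanced (fun a b => tens_lmul a b y).
Proof.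
split=> [a a' b|a b b'|a s b]; elim/tens_ind: y => [c d|x y IHx IHy].
- by rewrite !tens_lmulE mulrDl tpureDl.
- by rewrite !tens_lmulD IHx IHy addrACA.
- by rewrite !tens_lmulE mulrDl tpureDr.
- by rewrite !tens_lmulD IHx IHy addrACA.
- by rewrite !tens_lmulE -!scalerAl tpureZ.
- by rewrite !tens_lmulD IHx IHy.
Qed.

Lemma tens_mulE0 a b y : tens_mul (a ⊗ b) y = tens_lmul a b y.
Proof. exact: (tlift_pure (tens_mul_bal y)). Qed.

Lemma tens_mulDl : left_distributive tens_mul +%R.
Proof. by move=> x y z; apply: (tliftD (tens_mul_bal z)). Qed.

Lemma tens_mulDr : right_distributive tens_mul +%R.
Proof.
elim/tens_ind=> [a b|x y IHx IHy] z w; first by rewrite !tens_mulE0 tens_lmulD.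
by rewrite !tens_mulDl IHx IHy addrACA.
Qed.

Lemma tens_mulE a b c d : tens_mul (a ⊗ b) (c ⊗ d) = (a * c) ⊗ (b * d).
Proof. by rewrite tens_mulE0 tens_lmulE. Qed.

Lemma tens_mulA : associative tens_mul.
Proof.
elim/tens_ind=> [a b|x x' IH IH'] y z; last by rewrite !tens_mulDl IH IH'.
elim/tens_ind: y => [c d|y y' IH IH'].
  elim/tens_ind: z => [e f|z z' IH IH']; last by rewrite !tens_mulDr IH IH'.
  by rewrite !tens_mulE !mulrA.
by rewrite tens_mulDl !tens_mulDr tens_mulDl IH IH'.
Qed.

Lemma tens_mul1l : left_id tens_one tens_mul.
Proof.
elim/tens_ind=> [a b|x y IHx IHy]; first by rewrite tens_mulE !mul1r.
by rewrite tens_mulDr IHx IHy.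
Qed.

Lemma tens_mul1r : right_id tens_one tens_mul.
Proof.
elim/tens_ind=> [a b|x y IHx IHy]; first by rewrite tens_mulE !mulr1.
by rewrite tens_mulDl IHx IHy.
Qed.

Lemma tens_one_neq0 : tens_one != 0.
Proof.
have [phi [phiL phi1]] := unit_functional A.
pose f (a : A) (b : B) : B := phi a *: b.
have phi0 : phi 0 = 0.
  by have := phiL 1 0 0; rewrite scaler0 addr0 mul1r -[LHS]addr0 => /addrI.
have phiD x y : phi (x + y) = phi x + phi y.
  by have := phiL 1 x y; rewrite scale1r mul1r.
have phiZ c x : phi (c *: x) = c * phi x.
  by have := phiL c x 0; rewrite !addr0 phi0 addr0.
have fbal : kbalanced f.
  split=> [a a' b|a b b'|a s b]; rewrite /f.
  - by rewrite phiD scalerDl.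
  - by rewrite scalerDr.
  - by rewrite phiZ scalerA mulrC.
apply/eqP=> /(congr1 (tlift f)); rewrite (tlift_pure fbal) /f phi1 scale1r.
rewrite [RHS](blift0 fbal) => /eqP; by rewrite oner_eq0.
Qed.

HB.instance Definition _ := GRing.Zmodule_isNzRing.Build (tens A B)
  tens_mulA tens_mul1l tens_mul1r tens_mulDl tens_mulDr tens_one_neq0.

Lemma tpureM (a c : A) (b d : B) : (a ⊗ b) * (c ⊗ d) = (a * c) ⊗ (b * d).
Proof. exact: tens_mulE. Qed.

Lemma tens_scalerAl (c : k) (u v : tens A B) : c *: (u * v) = (c *: u) * v.
Proof.
elim/tens_ind: u => [a b|x y IHx IHy]; last first.
  by rewrite !(scalerDr, mulrDl) IHx IHy.
elim/tens_ind: v => [a' b'|x y IHx IHy]; last first.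
  by rewrite !(scalerDr, mulrDr) IHx IHy.
by rewrite tpureM !tens_scalel tpureM scalerAl.
Qed.

Lemma tens_scalerAr (c : k) (u v : tens A B) : c *: (u * v) = u * (c *: v).
Proof.
elim/tens_ind: u => [a b|x y IHx IHy]; last first.
  by rewrite !(scalerDr, mulrDl) IHx IHy.
elim/tens_ind: v => [a' b'|x y IHx IHy]; last first.
  by rewrite !(scalerDr, mulrDr) IHx IHy.
by rewrite tpureM !tens_scalel tpureM scalerAr.
Qed.

HB.instance Definition _ := GRing.Lmodule_isLalgebra.Build k (tens A B)
  tens_scalerAl.
HB.instance Definition _ := GRing.Lalgebra_isAlgebra.Build k (tens A B)
  tens_scalerAr.

End TensorOfAlgebras.

Section TensorMaps.
Variable k : fieldType.

Definition tmap (A B A' B' : lmodType k) (f : A -> A') (g : B -> B') :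
  tens A B -> tens A' B' := tlift (fun a b => f a ⊗ g b).

Definition tswap (A B : lmodType k) : tens A B -> tens B A :=
  tlift (fun a b => b ⊗ a).

(* a ⊗ (b ⊗ c) |-> (a ⊗ b) ⊗ c *)
Definition tassoc (A B C : lmodType k) :
    tens A (tens B C) -> tens (tens A B) C :=
  tlift (fun a => tlift (fun b c => a ⊗ b ⊗ c)).

Section TMap.
Variables (A B A' B' : lmodType k) (f : A -> A') (g : B -> B').
Hypotheses (fL : linear f) (gL : linear g).

Lemma linear_addZ (V W : lmodType k) (h : V -> W) : linear h ->
  {morph h : x y / x + y} * (forall c, {morph h : x / c *: x}).
Proof.
move=> hL.
have hD : {morph h : x y / x + y} by move=> x y; rewrite -[x]scale1r hL !scale1r.
split=> // c x.
have h0 : h 0 = 0 by apply: (addrI (h 0)); rewrite -hD !addr0.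
by rewrite -[c *: x]addr0 hL h0 addr0.
Qed.

Lemma tmap_bal : kbalanced (fun a b => f a ⊗ g b).
Proof.
have [fD fZ] := linear_addZ fL; have [gD gZ] := linear_addZ gL.
split=> [a a' b|a b b'|a s b].
- by rewrite fD tpureDl.
- by rewrite gD tpureDr.
- by rewrite fZ gZ tpureZ.
Qed.

Lemma tmap_pure a b : tmap f g (a ⊗ b) = f a ⊗ g b.
Proof. exact: (tlift_pure tmap_bal). Qed.

Lemma tmap_linear : linear (tmap f g).
Proof.
have [fD fZ] := linear_addZ fL.
have D := tliftD tmap_bal; move=> c x y; rewrite [LHS]D; congr (_ + _).
elim/tens_ind: x => [a b|x x' IH IH'].
  by rewrite tens_scalel -!/(tmap f g _) !tmap_pure fZ tens_scalel.
by rewrite !(scalerDr, D) [tmap f g _]D scalerDr IH IH'.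
Qed.
End TMap.

Lemma tswap_bal (A B : lmodType k) : kbalanced (fun (a : A) (b : B) => b ⊗ a).
Proof.
split=> [a a' b|a b b'|a s b]; by rewrite ?tpureDl ?tpureDr ?tpureZ.
Qed.

Lemma tswap_pure (A B : lmodType k) (a : A) (b : B) : tswap (a ⊗ b) = b ⊗ a.
Proof. exact: (tlift_pure (@tswap_bal A B)). Qed.

Lemma tswap_linear (A B : lmodType k) : linear (@tswap A B).
Proof.
have D := tliftD (@tswap_bal A B); move=> c x y; rewrite [LHS]D; congr (_ + _).
elim/tens_ind: x => [a b|x x' IH IH'].
  by rewrite tens_scalel -!/(tswap _) !tswap_pure tens_scaler.
by rewrite !(scalerDr, D) [tswap (_ + _)]D scalerDr IH IH'.
Qed.

Section TAssoc.
Variables (A B C : lmodType k).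

Lemma tassoc_bal1 (a : A) : kbalanced (fun (b : B) (c : C) => a ⊗ b ⊗ c).
Proof.
split=> [b b' c|b c c'|b s c].
- by rewrite tpureDr tpureDl.
- by rewrite tpureDr.
- by rewrite -tens_scaler tpureZ.
Qed.

Lemma tassoc_bal :
  kbalanced (fun a : A => tlift (fun (b : B) (c : C) => a ⊗ b ⊗ c)).
Proof.
have D a := tliftD (tassoc_bal1 a).
have E (a : A) (b : B) (c : C) :
    tlift (fun (b : B) (c : C) => a ⊗ b ⊗ c) (b ⊗ c) = a ⊗ b ⊗ c.
  exact: (tlift_pure (tassoc_bal1 a)).
split=> [a a' y|a y y'|a s y].
- elim/tens_ind: y => [b c|x y IHx IHy]; last by rewrite !D IHx IHy addrACA.
  by rewrite !E !tpureDl.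
- exact: D.
- elim/tens_ind: y => [b c|x y IHx IHy]; last by rewrite scalerDr !D IHx IHy.
  by rewrite tens_scalel !E tpureZ.
Qed.

Lemma tassoc_pure (a : A) (b : B) (c : C) : tassoc (a ⊗ (b ⊗ c)) = a ⊗ b ⊗ c.
Proof.
by rewrite /tassoc (tlift_pure tassoc_bal) (tlift_pure (tassoc_bal1 a)).
Qed.

Lemma tassocD : {morph @tassoc A B C : x y / x + y}.
Proof. exact: (tliftD tassoc_bal). Qed.

Lemma tassoc_linear : linear (@tassoc A B C).
Proof.
move=> s x y; rewrite tassocD; congr (_ + _).
elim/tens_ind: x => [a bc|x x' IH IH']; last by rewrite !(scalerDr, tassocD) IH IH'.
elim/tens_ind: bc => [b c|x x' IH IH'].
  by rewrite tens_scalel !tassoc_pure !tens_scalel.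
by rewrite tpureDr !(scalerDr, tassocD) IH IH'.
Qed.
End TAssoc.

Definition alg_morph (A B : algType k) (f : A -> B) :=
  [/\ linear f, f 1 = 1 & {morph f : x y / x * y}].

Lemma alg_morph_id (A : algType k) : alg_morph (@id A).
Proof. by []. Qed.

Lemma alg_morph_comp (A B C : algType k) (g : B -> C) (f : A -> B) :
  alg_morph g -> alg_morph f -> alg_morph (g \o f).
Proof.
case=> gL g1 gM [fL f1 fM]; split=> [c x y||x y] /=.
- by rewrite fL gL.
- by rewrite f1 g1.
- by rewrite fM gM.
Qed.

Lemma tens_morphM (A B : algType k) (C : algType k) (f : tens A B -> C) :
  {morph f : x y / x + y} ->
  (forall a b a' b', f ((a ⊗ b) * (a' ⊗ b')) = f (a ⊗ b) * f (a' ⊗ b')) ->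
  {morph f : x y / x * y}.
Proof.
move=> fD fM x y; elim/tens_ind: x => [a b|x x' IH IH'].
  elim/tens_ind: y => [a' b'|y y' IH IH']; first exact: fM.
  by rewrite mulrDr !fD IH IH' mulrDr.
by rewrite mulrDl !fD IH IH' mulrDl.
Qed.

Lemma tmap_alg (A B A' B' : algType k) (f : A -> A') (g : B -> B') :
  alg_morph f -> alg_morph g -> alg_morph (tmap f g).
Proof.
case=> fL f1 fM [gL g1 gM]; split; first exact: tmap_linear.
- by rewrite tmap_pure // f1 g1.
- apply: tens_morphM => [|a b a' b']; first exact: (tliftD (tmap_bal fL gL)).
  by rewrite tpureM !tmap_pure // fM gM tpureM.
Qed.

Lemma tswap_alg (A B : algType k) : alg_morph (@tswap A B).
Proof.
split; [exact: tswap_linear|by rewrite tswap_pure|].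
apply: tens_morphM => [|a b a' b']; first exact: (tliftD (@tswap_bal A B)).
by rewrite tpureM !tswap_pure tpureM.
Qed.

Lemma tassoc_alg (A B C : algType k) : alg_morph (@tassoc A B C).
Proof.
split; [exact: tassoc_linear|by rewrite tassoc_pure|].
apply: tens_morphM => [|a y a' y']; first exact: tassocD.
elim/tens_ind: y => [b c|y1 y2 IH1 IH2]; last first.
  by rewrite tpureDr mulrDl !tassocD mulrDl IH1 IH2.
elim/tens_ind: y' => [b' c'|y1 y2 IH1 IH2]; last first.
  by rewrite tpureDr mulrDr !tassocD mulrDr IH1 IH2.
by rewrite !tpureM !tassoc_pure !tpureM.
Qed.

End TensorMaps.

(* The universal enveloping algebra: the associative unital k-algebra         *)
(* presented by the generators UVar x (x in L), linear in x, and the          *)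
(* relations UVar [x, y] = UVar x UVar y - UVar y UVar x. The scalar c is     *)
(* UScal c; in particular 0, 1 and - u are UScal 0, UScal 1 and (-1) u.       *)
Section Enveloping.
Variables (k : fieldType) (L : lieAlgType k).

Inductive uterm :=
| UVar of L | UScal of k | UAdd of uterm & uterm | UMul of uterm & uterm.

Inductive ueq : uterm -> uterm -> Prop :=
| ueq_refl u : ueq u u
| ueq_sym u v : ueq u v -> ueq v u
| ueq_trans v u w : ueq u v -> ueq v w -> ueq u w
| ueq_add u u' v v' : ueq u u' -> ueq v v' -> ueq (UAdd u v) (UAdd u' v')
| ueq_mul u u' v v' : ueq u u' -> ueq v v' -> ueq (UMul u v) (UMul u' v')
| ueq_addA u v w : ueq (UAdd u (UAdd v w)) (UAdd (UAdd u v) w)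
| ueq_addC u v : ueq (UAdd u v) (UAdd v u)
| ueq_add0 u : ueq (UAdd (UScal 0) u) u
| ueq_mulA u v w : ueq (UMul u (UMul v w)) (UMul (UMul u v) w)
| ueq_mulDl u v w : ueq (UMul (UAdd u v) w) (UAdd (UMul u w) (UMul v w))
| ueq_mulDr u v w : ueq (UMul u (UAdd v w)) (UAdd (UMul u v) (UMul u w))
| ueq_mul0 u : ueq (UMul (UScal 0) u) (UScal 0)
| ueq_mul1 u : ueq (UMul (UScal 1) u) u
| ueq_scalD c d : ueq (UScal (c + d)) (UAdd (UScal c) (UScal d))
| ueq_scalM c d : ueq (UScal (c * d)) (UMul (UScal c) (UScal d))
| ueq_scalC c u : ueq (UMul (UScal c) u) (UMul u (UScal c))
| ueq_varD x y : ueq (UVar (x + y)) (UAdd (UVar x) (UVar y))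
| ueq_varZ c x : ueq (UVar (c *: x)) (UMul (UScal c) (UVar x))
| ueq_lie x y : ueq (UVar (lieb x y))
    (UAdd (UMul (UVar x) (UVar y))
          (UMul (UScal (-1)) (UMul (UVar y) (UVar x)))).

HB.instance Definition _ := gen_eqMixin uterm.
HB.instance Definition _ := gen_choiceMixin uterm.

Definition u_equiv := asbool_equiv_rel ueq_refl ueq_sym ueq_trans.
Definition uenv := {eq_quot u_equiv}.
HB.instance Definition _ := Choice.on uenv.
HB.instance Definition _ := Quotient.on uenv.

Lemma uenvP u v : (\pi_uenv u = \pi_uenv v) <-> ueq u v.
Proof. exact: pi_asboolP. Qed.

Lemma uenv_repr u : ueq (repr (\pi_uenv u)) u.
Proof. by apply/uenvP; rewrite reprK. Qed.

Definition uiota (x : L) : uenv := \pi_uenv (UVar x).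
Definition uscal (c : k) : uenv := \pi_uenv (UScal c).
Definition uadd (u v : uenv) : uenv := \pi_uenv (UAdd (repr u) (repr v)).
Definition umul (u v : uenv) : uenv := \pi_uenv (UMul (repr u) (repr v)).
Definition uopp (u : uenv) : uenv := umul (uscal (-1)) u.

Lemma uaddE u v : uadd (\pi_uenv u) (\pi_uenv v) = \pi_uenv (UAdd u v).
Proof. by apply/uenvP; apply: ueq_add; apply: uenv_repr. Qed.
Lemma umulE u v : umul (\pi_uenv u) (\pi_uenv v) = \pi_uenv (UMul u v).
Proof. by apply/uenvP; apply: ueq_mul; apply: uenv_repr. Qed.

Lemma uaddA : associative uadd.
Proof.
elim/quotW=> x; elim/quotW=> y; elim/quotW=> z.
rewrite (uaddE y z) (uaddE x y) !uaddE.
by apply/uenvP; apply: ueq_addA.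
Qed.
Lemma uaddC : commutative uadd.
Proof.
by elim/quotW=> x; elim/quotW=> y; rewrite !uaddE; apply/uenvP; apply: ueq_addC.
Qed.
Lemma uadd0 : left_id (uscal 0) uadd.
Proof. by elim/quotW=> x; rewrite uaddE; apply/uenvP; apply: ueq_add0. Qed.
Lemma umulA : associative umul.
Proof.
elim/quotW=> x; elim/quotW=> y; elim/quotW=> z.
rewrite (umulE y z) (umulE x y) !umulE.
by apply/uenvP; apply: ueq_mulA.
Qed.
Lemma umulDl : left_distributive umul uadd.
Proof.
elim/quotW=> x; elim/quotW=> y; elim/quotW=> z.
rewrite (uaddE x y) (umulE x z) (umulE y z) umulE uaddE.
by apply/uenvP; apply: ueq_mulDl.
Qed.
Lemma umulDr : right_distributive umul uadd.
Proof.
elim/quotW=> x; elim/quotW=> y; elim/quotW=> z.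
rewrite (uaddE y z) (umulE x y) (umulE x z) umulE uaddE.
by apply/uenvP; apply: ueq_mulDr.
Qed.
Lemma umul0 u : umul (uscal 0) u = uscal 0.
Proof. by elim/quotW: u => x; rewrite umulE; apply/uenvP; apply: ueq_mul0. Qed.
Lemma umul1 : left_id (uscal 1) umul.
Proof. by elim/quotW=> x; rewrite umulE; apply/uenvP; apply: ueq_mul1. Qed.
Lemma uscalC c u : umul (uscal c) u = umul u (uscal c).
Proof. by elim/quotW: u => x; rewrite !umulE; apply/uenvP; apply: ueq_scalC. Qed.
Lemma uscalD c d : uscal (c + d) = uadd (uscal c) (uscal d).
Proof. by rewrite uaddE; apply/uenvP; apply: ueq_scalD. Qed.
Lemma uscalM c d : uscal (c * d) = umul (uscal c) (uscal d).
Proof. by rewrite umulE; apply/uenvP; apply: ueq_scalM. Qed.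
Lemma umul1r : right_id (uscal 1) umul.
Proof. by move=> u; rewrite -uscalC umul1. Qed.
Lemma uaddN : left_inverse (uscal 0) uopp uadd.
Proof.
by move=> u; rewrite /uopp -{2}[u]umul1 -umulDl -uscalD addNr umul0.
Qed.

HB.instance Definition _ := GRing.isZmodule.Build uenv uaddA uaddC uadd0 uaddN.

Section Eval.
Variables (B : algType k) (f : L -> B).

Fixpoint ueval (u : uterm) : B :=
  match u with
  | UVar x => f x
  | UScal c => c *: 1
  | UAdd u v => ueval u + ueval v
  | UMul u v => ueval u * ueval v
  end.

Definition lie_morph :=
  linear f /\ forall x y, f (lieb x y) = f x * f y - f y * f x.

Lemma ueval_eq u v : lie_morph -> ueq u v -> ueval u = ueval v.
Proof.
case=> /linear_addZ[fD fZ] fb.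
elim=> //= {u v}.
- by move=> v u w _ -> _ ->.
- by move=> u u' v v' _ -> _ ->.
- by move=> u u' v v' _ -> _ ->.
- by move=> u v w; rewrite addrA.
- by move=> u v; rewrite addrC.
- by move=> u; rewrite scale0r add0r.
- by move=> u v w; rewrite mulrA.
- by move=> u v w; rewrite mulrDl.
- by move=> u v w; rewrite mulrDr.
- by move=> u; rewrite scale0r mul0r.
- by move=> u; rewrite scale1r mul1r.
- by move=> c d; rewrite scalerDl.
- by move=> c d; rewrite -scalerAl mul1r scalerA.
- by move=> c u; rewrite -scalerAl -scalerAr mul1r mulr1.
- by move=> c x; rewrite fZ -scalerAl mul1r.
- by move=> x y; rewrite fb scaleN1r mulN1r.
Qed.
End Eval.

(* the augmentation of U(L) sends 1 to 1 and 0 to 0 *)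
Lemma uone_neq0 : uscal 1 != uscal 0.
Proof.
have f0 : @lie_morph k^o (fun=> 0).
  by split=> [c x y|x y]; rewrite ?scaler0 ?addr0 // mul0r subrr.
apply/eqP=> /uenvP /(ueval_eq f0) /= /eqP.
by rewrite scale1r scale0r oner_eq0.
Qed.

HB.instance Definition _ := GRing.Zmodule_isNzRing.Build uenv
  umulA umul1 umul1r umulDl umulDr uone_neq0.

Definition uscale (c : k) (u : uenv) : uenv := uscal c * u.

Lemma uscaleA a b v : uscale a (uscale b v) = uscale (a * b) v.
Proof. by rewrite /uscale mulrA -[uscal (a * b)]/(uscal (a * b)) uscalM. Qed.
Lemma uscale1 : left_id 1 uscale.
Proof. exact: mul1r. Qed.
Lemma uscaleDr : right_distributive uscale +%R.
Proof. by move=> c x y; apply: mulrDr. Qed.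
Lemma uscaleDl v : {morph uscale^~ v : a b / a + b}.
Proof. by move=> a b; rewrite /uscale uscalD; apply: mulrDl. Qed.
HB.instance Definition _ := GRing.Zmodule_isLmodule.Build k uenv
  uscaleA uscale1 uscaleDr uscaleDl.

Lemma uscalerAl (c : k) (u v : uenv) : c *: (u * v) = (c *: u) * v.
Proof. exact: mulrA. Qed.
Lemma uscalerAr (c : k) (u v : uenv) : c *: (u * v) = u * (c *: v).
Proof. by rewrite [LHS]mulrA [uscal c * u]uscalC -[LHS]mulrA. Qed.
HB.instance Definition _ := GRing.Lmodule_isLalgebra.Build k uenv uscalerAl.
HB.instance Definition _ := GRing.Lalgebra_isAlgebra.Build k uenv uscalerAr.

Lemma uscal_scale (c : k) : uscal c = c *: 1.
Proof. by rewrite [RHS]mulr1. Qed.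

Lemma uiota_linear : linear uiota.
Proof.
move=> c x y.
have -> : c *: uiota x = \pi_uenv (UMul (UScal c) (UVar x)).
  by rewrite -umulE.
rewrite [RHS]uaddE; apply/uenvP.
by apply: ueq_trans (ueq_varD _ _) _; apply: ueq_add (ueq_varZ _ _) (ueq_refl _).
Qed.

Lemma uiota_lie x y : uiota (lieb x y) = uiota x * uiota y - uiota y * uiota x.
Proof.
have ->: - (uiota y * uiota x) = umul (uscal (-1)) (umul (uiota y) (uiota x)).
  by [].
by rewrite [_ * _]umulE [umul (uiota y) _]umulE umulE [_ + _]uaddE;
  apply/uenvP; apply: ueq_lie.
Qed.

Lemma uenv_ind (Q : uenv -> Prop) :
  (forall x, Q (uiota x)) -> (forall c, Q (c *: 1)) ->
  (forall u v, Q u -> Q v -> Q (u + v)) ->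
  (forall u v, Q u -> Q v -> Q (u * v)) -> forall u, Q u.
Proof.
move=> Qi Qs QD QM; elim/quotW; elim=> [x|c|u Qu v Qv|u Qu v Qv].
- exact: Qi.
- by rewrite -/(uscal c) uscal_scale.
- by rewrite -[\pi_uenv _]uaddE; apply: QD.
- by rewrite -[\pi_uenv _]umulE; apply: QM.
Qed.

Section Lift.
Variables (B : algType k) (f : L -> B).

(* The algebra morphism extending f; meaningful when f is a Lie morphism. *)
Definition ulift (u : uenv) : B := ueval f (repr u).

Hypothesis fL : lie_morph f.

Lemma ulift_pi u : ulift (\pi_uenv u) = ueval f u.
Proof. by apply: (ueval_eq fL); apply: uenv_repr. Qed.
Lemma ulift_iota x : ulift (uiota x) = f x.
Proof. exact: ulift_pi. Qed.
Lemma ulift_scal c : ulift (c *: 1) = c *: 1.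
Proof. by rewrite -uscal_scale ulift_pi. Qed.
Lemma ulift1 : ulift 1 = 1.
Proof. by rewrite -[1 in LHS]scale1r ulift_scal scale1r. Qed.
Lemma uliftD : {morph ulift : u v / u + v}.
Proof.
by elim/quotW=> u; elim/quotW=> v; rewrite [_ + _]uaddE !ulift_pi.
Qed.
Lemma uliftM : {morph ulift : u v / u * v}.
Proof.
by elim/quotW=> u; elim/quotW=> v; rewrite [_ * _]umulE !ulift_pi.
Qed.
Lemma ulift_linear : linear ulift.
Proof.
move=> c u v; rewrite uliftD; congr (_ + _).
by rewrite -[u in LHS]mul1r uscalerAl uliftM ulift_scal -scalerAl mul1r.
Qed.
Lemma ulift_alg : alg_morph ulift.
Proof. by split; [exact: ulift_linear|exact: ulift1|exact: uliftM]. Qed.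
Lemma ulift_uniq (g : uenv -> B) :
  alg_morph g -> (forall x, g (uiota x) = f x) -> g =1 ulift.
Proof.
case=> /linear_addZ[gD gZ] g1 gM gf.
elim/uenv_ind=> [x|c|u v IHu IHv|u v IHu IHv].
- by rewrite gf ulift_iota.
- by rewrite gZ g1 ulift_scal.
- by rewrite gD uliftD IHu IHv.
- by rewrite gM uliftM IHu IHv.
Qed.
End Lift.

Lemma uenv_ext (B : algType k) (f g : uenv -> B) :
  alg_morph f -> alg_morph g ->
  (forall x, f (uiota x) = g (uiota x)) -> f =1 g.
Proof.
case=> /linear_addZ[fD fZ] f1 fM [/linear_addZ[gD gZ] g1 gM] fg.
elim/uenv_ind=> [//|c|u v IHu IHv|u v IHu IHv].
- by rewrite fZ gZ f1 g1.
- by rewrite fD gD IHu IHv.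
- by rewrite fM gM IHu IHv.
Qed.
End Enveloping.

Section Coproduct.
Variables (k : fieldType) (L : lieAlgType k).
Local Notation H := (uenv L).
Local Notation HH := (tens H H).
Local Notation HHH := (tens HH H).

Definition Delta : H -> HH := ulift (fun x => uiota x ⊗ 1 + 1 ⊗ uiota x).

Definition Delta_id : HH -> HHH := tmap Delta id.
Definition id_Delta (z : HH) : HHH := tassoc (tmap id Delta z).
Definition Delta3 (h : H) : HHH := Delta_id (Delta h).

Definition perm12 : HHH -> HHH := tmap (@tswap _ _ _) id.
Definition tens_1 (b : HH) : HHH := b ⊗ 1.
Definition one_tens (b : HH) : HHH := tassoc (1 ⊗ b).

Lemma Delta_lie : lie_morph (fun x : L => uiota x ⊗ 1 + 1 ⊗ uiota x : HH).
Proof.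
split=> [c x y|x y].
  rewrite uiota_linear tpureDl tpureDr addrACA scalerDr.
  by rewrite tens_scalel tens_scaler.
rewrite uiota_lie !mulrDl !mulrDr !tpureM !mul1r !mulr1.
rewrite (_ : forall a b : H, (a - b) ⊗ (1 : H) = a ⊗ 1 - b ⊗ 1); last first.
  by move=> a b; rewrite tpureDl -scaleN1r -tens_scalel scaleN1r.
rewrite (_ : forall a b : H, (1 : H) ⊗ (a - b) = 1 ⊗ a - 1 ⊗ b); last first.
  by move=> a b; rewrite tpureDr -scaleN1r -tens_scaler scaleN1r.
have aux (V : zmodType) (p p' q q' u v : V) :
    p - p' + (q - q') = p + u + (v + q) - (p' + v + (u + q')).
  rewrite [v + q]addrC [u + q']addrC [p + u + _]addrACA [p' + v + _]addrACA.
  by rewrite [v + u]addrC opprD [RHS]addrACA subrr addr0 opprD addrACA.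
exact: aux.
Qed.

Lemma Delta_iota x : Delta (uiota x) = uiota x ⊗ 1 + 1 ⊗ uiota x.
Proof. exact: ulift_iota Delta_lie _. Qed.
Lemma Delta_alg : alg_morph Delta.
Proof. exact: ulift_alg Delta_lie. Qed.
Lemma Delta1 : Delta 1 = 1.
Proof. exact: ulift1 Delta_lie. Qed.
Lemma DeltaD : {morph Delta : u v / u + v}.
Proof. exact: uliftD Delta_lie. Qed.
Lemma DeltaM : {morph Delta : u v / u * v}.
Proof. exact: uliftM Delta_lie. Qed.
Lemma Delta_linear : linear Delta.
Proof. exact: ulift_linear Delta_lie. Qed.

Lemma Delta_id_pure f g : Delta_id (f ⊗ g) = Delta f ⊗ g.
Proof. by apply: tmap_pure => //; apply: Delta_linear. Qed.
Lemma id_Delta_pure f g : id_Delta (f ⊗ g) = tassoc (f ⊗ Delta g).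
Proof. by rewrite /id_Delta tmap_pure //; apply: Delta_linear. Qed.
Lemma perm12_pure f h g : perm12 (f ⊗ h ⊗ g) = h ⊗ f ⊗ g.
Proof.
rewrite /perm12 tmap_pure ?tswap_pure //; exact: tswap_linear.
Qed.

Lemma Delta_id_alg : alg_morph Delta_id.
Proof. exact: tmap_alg Delta_alg (@alg_morph_id _ _). Qed.
Lemma id_Delta_alg : alg_morph id_Delta.
Proof.
apply: (alg_morph_comp (@tassoc_alg _ H H H)).
exact: tmap_alg (@alg_morph_id _ _) Delta_alg.
Qed.
Lemma Delta3_alg : alg_morph Delta3.
Proof. exact: alg_morph_comp Delta_id_alg Delta_alg. Qed.
Lemma perm12_alg : alg_morph perm12.
Proof. exact: tmap_alg (@tswap_alg _ H H) (@alg_morph_id _ _). Qed.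

Lemma Delta_coassoc h : id_Delta (Delta h) = Delta3 h.
Proof.
move: h; apply: uenv_ext; [exact: alg_morph_comp id_Delta_alg Delta_alg| |].
  exact: Delta3_alg.
move=> x; have [iL _ _] := id_Delta_alg; have [lL _ _] := Delta_id_alg.
have [iD _] := linear_addZ iL; have [lD _] := linear_addZ lL.
rewrite /= /Delta3 Delta_iota iD lD !id_Delta_pure !Delta_id_pure Delta1.
rewrite Delta_iota tpureDr tpureDl tassocD !tassoc_pure.
by rewrite addrA.
Qed.

Lemma Delta_cocomm h : tswap (Delta h) = Delta h.
Proof.
move: h; apply: uenv_ext.
- exact: alg_morph_comp (@tswap_alg _ H H) Delta_alg.
- exact: Delta_alg.
move=> x; have [sD _] := linear_addZ (@tswap_linear _ H H).
by rewrite /= Delta_iota sD !tswap_pure addrC.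
Qed.

Lemma perm12_Delta3 h : perm12 (Delta3 h) = Delta3 h.
Proof.
have [/linear_addZ[pD _] _ _] := perm12_alg.
have [/linear_addZ[lD _] _ _] := Delta_id_alg.
rewrite /Delta3; elim/tens_ind: (Delta h) => [a b|x y IHx IHy].
  rewrite Delta_id_pure /perm12 tmap_pure ?Delta_cocomm //.
  exact: tswap_linear.
by rewrite lD pD IHx IHy.
Qed.

Lemma one_tens_alg : alg_morph one_tens.
Proof.
split=> [c x y||x y].
- by rewrite /one_tens tpureDr -tens_scaler tassoc_linear.
- by rewrite /one_tens tassoc_pure.
- have [_ _ tM] := @tassoc_alg _ H H H.
  by rewrite /one_tens -tM tpureM mul1r.
Qed.

Lemma one_tens_pure f g : one_tens (f ⊗ g) = 1 ⊗ f ⊗ g.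
Proof. exact: tassoc_pure. Qed.

End Coproduct.

(* B ⊗_H A, for H acting on B on the right through D : H -> B; it is a left   *)
(* B-module by multiplication on the left factor.                             *)
Section BaseChange.
Variables (H B : nzRingType) (D : H -> B) (A : lmodType H).
Definition bchange : Type :=
  btens (fun (b : B) (h : H) => b * D h) (fun (h : H) (a : A) => h *: a).
HB.instance Definition _ := GRing.Zmodule.on bchange.
Definition bcpure (b : B) (a : A) : bchange := bpure _ _ b a.

Lemma bcpureDl b b' a : bcpure (b + b') a = bcpure b a + bcpure b' a.
Proof. exact: bpureDl. Qed.
Lemma bcpureDr b a a' : bcpure b (a + a') = bcpure b a + bcpure b a'.
Proof. exact: bpureDr. Qed.
Lemma bcpure_bal b h a : bcpure (b * D h) a = bcpure b (h *: a).
Proof. exact: bpure_bal. Qed.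

Definition bcbalanced (V : zmodType) (f : B -> A -> V) :=
  balanced (fun (b : B) (h : H) => b * D h) (fun (h : H) (a : A) => h *: a) f.

Definition bclift (V : zmodType) (f : B -> A -> V) : bchange -> V := blift f.

Lemma bclift_pure (V : zmodType) (f : B -> A -> V) : bcbalanced f ->
  forall b a, bclift f (bcpure b a) = f b a.
Proof. by move=> fbal b a; apply: (blift_pure fbal). Qed.
Lemma bcliftD (V : zmodType) (f : B -> A -> V) : bcbalanced f ->
  {morph bclift f : x y / x + y}.
Proof. by move=> fbal x y; apply: (bliftD fbal). Qed.

Definition bcscale (c : B) : bchange -> bchange :=
  bclift (fun b a => bcpure (c * b) a).

Lemma bcscale_bal c : bcbalanced (fun b a => bcpure (c * b) a).
Proof.
split=> [b b' a|b a a'|b h a].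
- by rewrite mulrDr bcpureDl.
- by rewrite bcpureDr.
- by rewrite mulrA bcpure_bal.
Qed.

Lemma bcscaleE c b a : bcscale c (bcpure b a) = bcpure (c * b) a.
Proof. exact: (bclift_pure (bcscale_bal c)). Qed.
Lemma bcscaleD c : {morph bcscale c : x y / x + y}.
Proof. exact: (bcliftD (bcscale_bal c)). Qed.

Lemma bcscaleA c d v : bcscale c (bcscale d v) = bcscale (c * d) v.
Proof.
move: v; apply: btens_ext=> [x y|x y|b a]; rewrite ?bcscaleD //.
by rewrite -/(bcpure b a) !bcscaleE mulrA.
Qed.
Lemma bcscale1 : left_id 1 bcscale.
Proof.
apply: btens_ext=> [x y|x y|b a]; rewrite ?bcscaleD //.
by rewrite -/(bcpure b a) bcscaleE mul1r.
Qed.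
Lemma bcscaleDl v : {morph bcscale^~ v : c d / c + d}.
Proof.
move=> c d /=; move: v; apply: btens_ext=> [x y|x y|b a].
- by rewrite bcscaleD.
- by rewrite !bcscaleD addrACA.
- by rewrite -/(bcpure b a) !bcscaleE mulrDl bcpureDl.
Qed.
HB.instance Definition _ := GRing.Zmodule_isLmodule.Build B bchange
  bcscaleA bcscale1 bcscaleD bcscaleDl.

Lemma bcpureZ c b a : c *: bcpure b a = bcpure (c * b) a.
Proof. exact: bcscaleE. Qed.

Lemma bc_ind (Q : bchange -> Prop) :
  (forall b a, Q (bcpure b a)) -> (forall x y, Q x -> Q y -> Q (x + y)) ->
  forall x, Q x.
Proof.
have bc0 : 0 = bcpure 0 0 by rewrite -[in RHS](mul0r 0) -bcpureZ scale0r.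
move=> Qp QD; elim/btens_ind=> [//||x Qx|//]; first by rewrite bc0; apply: Qp.
have {Qx}: forall c, Q (c *: (x : bchange)).
  move: x {Qx}; elim/btens_ind=> [b a||x IH|x y IHx IHy] c.
  - by rewrite -/(bcpure b a) bcpureZ; apply: Qp.
  - by rewrite (scaler0 _ c) bc0; apply: Qp.
  - by rewrite scalerN -scaleNr; apply: IH.
  - by rewrite scalerDr; apply: QD.
by move=> /(_ (-1)); rewrite scaleN1r.
Qed.
End BaseChange.

(* phi ⊗_H id, for phi a ring morphism with phi \o D = D' *)
Section BaseChangeMap.
Variables (H B B' : nzRingType) (D : H -> B) (D' : H -> B') (A : lmodType H).
Variable phi : B -> B'.
Definition bmap : bchange D A -> bchange D' A :=
  bclift (fun b a => bcpure D' (phi b) a).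

Hypotheses (phiD : {morph phi : x y / x + y}).
Hypothesis (phiM : forall b h, phi (b * D h) = phi b * D' h).

Lemma bmap_bal : bcbalanced D (fun (b : B) (a : A) => bcpure D' (phi b) a).
Proof.
split=> [b b' a|b a a'|b h a].
- by rewrite phiD bcpureDl.
- by rewrite bcpureDr.
- by rewrite phiM bcpure_bal.
Qed.
Lemma bmap_pure b a : bmap (bcpure D b a) = bcpure D' (phi b) a.
Proof. exact: (bclift_pure bmap_bal). Qed.
Lemma bmapD : {morph bmap : x y / x + y}.
Proof. exact: (bcliftD bmap_bal). Qed.
Lemma bmapZ : {morph phi : x y / x * y} ->
  forall c x, bmap (c *: x) = phi c *: bmap x.
Proof.
move=> phiMM c; elim/bc_ind=> [b a|x y IHx IHy].
  by rewrite bcpureZ !bmap_pure bcpureZ phiMM.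
by rewrite scalerDr !bmapD scalerDr IHx IHy.
Qed.
End BaseChangeMap.

Notation "b ⊗H a" := (bcpure (@Delta _ _) b a)
  (at level 40, left associativity) : ring_scope.

HB.mixin Record Lmodule_isPseudoalgebra (k : fieldType) (L : lieAlgType k) A
    of GRing.Lmodule (uenv L) A := {
  pprod : A -> A -> bchange (@Delta k L) A;
  pprodDl : forall x x' y, pprod (x + x') y = pprod x y + pprod x' y;
  pprodDr : forall x y y', pprod x (y + y') = pprod x y + pprod x y';
  pprodZ : forall (h g : uenv L) x y,
    pprod (h *: x) (g *: y) = (h ⊗ g) *: pprod x y
}.

#[short(type="pseudoalgType")]
HB.structure Definition Pseudoalgebra (k : fieldType) (L : lieAlgType k) :=
  {A of Lmodule_isPseudoalgebra k L A & GRing.Lmodule (uenv L) A}.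

Notation "x ∗ y" := (pprod x y) (at level 40, left associativity) : ring_scope.

Section LeftPreLie.
Variables (k : fieldType) (L : lieAlgType k) (A : pseudoalgType L).
Local Notation H := (uenv L).
Local Notation HH := (tens H H).
Local Notation A2 := (bchange (@Delta k L) A).
Local Notation A3 := (bchange (@Delta3 k L) A).

(* With x ∗ y = sum_i alpha_i ⊗_H c_i,                                        *)
(* (beta ⊗_H x) ∗ y = sum_i (beta ⊗ 1) (Delta ⊗ id)(alpha_i) ⊗_H c_i and      *)
(* x ∗ (beta ⊗_H y) = sum_i (1 ⊗ beta) (id ⊗ Delta)(alpha_i) ⊗_H c_i;         *)
(* see pprodl_pure, pprodr_pure, bmap_Delta_id and bmap_id_Delta.             *)
Definition pprodl (w : A2) (y : A) : A3 :=
  bclift (fun (b : HH) (x : A) => tens_1 b *: bmap _ (@Delta_id k L) (x ∗ y)) w.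
Definition pprodr (x : A) (w : A2) : A3 :=
  bclift (fun (b : HH) (y : A) => one_tens b *: bmap _ (@id_Delta k L) (x ∗ y)) w.
Definition act12 : A3 -> A3 := bmap _ (@perm12 k L).

Definition left_prelie := forall x y z : A,
  pprodl (x ∗ y) z - pprodr x (y ∗ z)
  = act12 (pprodl (y ∗ x) z - pprodr y (x ∗ z)).

Lemma Delta_id_bal : {morph @Delta_id k L : x y / x + y} *
  (forall b h, Delta_id (b * @Delta k L h) = Delta_id b * Delta3 h).
Proof.
have [/linear_addZ[fD _] _ fM] := @Delta_id_alg k L.
by split=> // b h; rewrite fM.
Qed.
Lemma id_Delta_bal : {morph @id_Delta k L : x y / x + y} *
  (forall b h, id_Delta (b * @Delta k L h) = id_Delta b * Delta3 h).
Proof.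
have [/linear_addZ[fD _] _ fM] := @id_Delta_alg k L.
by split=> // b h; rewrite fM Delta_coassoc.
Qed.
Lemma perm12_bal : {morph @perm12 k L : x y / x + y} *
  (forall b h, perm12 (b * @Delta3 k L h) = perm12 b * Delta3 h).
Proof.
have [/linear_addZ[fD _] _ fM] := @perm12_alg k L.
by split=> // b h; rewrite fM perm12_Delta3.
Qed.

Lemma bmap_Delta_id (b : HH) (a : A) :
  bmap _ (@Delta_id k L) (b ⊗H a) = bcpure (@Delta3 k L) (Delta_id b) a.
Proof. by have [fD fb] := Delta_id_bal; apply: bmap_pure. Qed.
Lemma bmap_id_Delta (b : HH) (a : A) :
  bmap _ (@id_Delta k L) (b ⊗H a) = bcpure (@Delta3 k L) (id_Delta b) a.
Proof. by have [fD fb] := id_Delta_bal; apply: bmap_pure. Qed.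
Lemma act12_pure b (a : A) :
  act12 (bcpure (@Delta3 k L) b a) = bcpure (@Delta3 k L) (perm12 b) a.
Proof. by have [fD fb] := perm12_bal; apply: bmap_pure. Qed.

Lemma pprodl_bal (y : A) : bcbalanced (@Delta k L)
  (fun (b : HH) (x : A) => tens_1 b *: bmap (@Delta3 k L) (@Delta_id k L) (x ∗ y)).
Proof.
have [fD fb] := Delta_id_bal; have [_ _ fM] := @Delta_id_alg k L.
split=> [b b' x|b x x'|b h x].
- by rewrite /tens_1 tpureDl scalerDl.
- by rewrite pprodDl bmapD // scalerDr.
- rewrite -[y in h *: x ∗ y]scale1r pprodZ bmapZ // scalerA; congr (_ *: _).
  by rewrite Delta_id_pure /tens_1 tpureM mulr1.
Qed.

Lemma pprodr_bal (x : A) : bcbalanced (@Delta k L)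
  (fun (b : HH) (y : A) => one_tens b *: bmap (@Delta3 k L) (@id_Delta k L) (x ∗ y)).
Proof.
have [fD fb] := id_Delta_bal; have [_ _ fM] := @id_Delta_alg k L.
have [/linear_addZ[oD _] _ oM] := @one_tens_alg k L.
split=> [b b' y|b y y'|b h y].
- by rewrite oD scalerDl.
- by rewrite pprodDr bmapD // scalerDr.
- rewrite -[x in x ∗ (h *: y)]scale1r pprodZ bmapZ // scalerA; congr (_ *: _).
  by rewrite id_Delta_pure oM.
Qed.

Lemma pprodl_pure (b : HH) (x y : A) :
  pprodl (b ⊗H x) y = tens_1 b *: bmap _ (@Delta_id k L) (x ∗ y).
Proof. exact: (bclift_pure (pprodl_bal y)). Qed.
Lemma pprodr_pure (b : HH) (x y : A) :
  pprodr x (b ⊗H y) = one_tens b *: bmap _ (@id_Delta k L) (x ∗ y).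
Proof. exact: (bclift_pure (pprodr_bal x)). Qed.
Lemma pprodlD (y : A) : {morph pprodl^~ y : v w / v + w}.
Proof. exact: (bcliftD (pprodl_bal y)). Qed.
Lemma pprodrD (x : A) : {morph pprodr x : v w / v + w}.
Proof. exact: (bcliftD (pprodr_bal x)). Qed.

End LeftPreLie.

Definition is_basis2 (R : nzRingType) (M : lmodType R) (e1 e2 : M) :=
  forall x : M, exists! c : R * R, x = c.1 *: e1 + c.2 *: e2.

(* Main.v *)
Require Import Defs.
From HB Require Import structures.
From mathcomp Require Import all_boot all_order all_algebra.
From mathcomp Require Import boolp classical_sets.
From mathcomp Require Import mpoly.

Set Implicit Arguments.
Unset Strict Implicit.
Unset Printing Implicit Defensive.

Import GRing.Theory.
Local Open Scope ring_scope.

(** Write [H] for the enveloping algebra, and expand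
    [e1 ∗ e2 = A ⊗H e1 + B ⊗H e2], [e2 ∗ e1 = C ⊗H e1 + D ⊗H e2] with
    [A], [B], [C], [D] in [H ⊗ H]. The coordinates of the left pre-Lie identity on
    basis vectors are equations between elements of [H ⊗ H ⊗ H] that are quadratic
    in these four tensors ([left_prelie_equations]). They are solved by comparing
    degrees slot by slot. For instance [(1 ⊗ C)(id ⊗ Delta)(C)] has in the second
    slot the sum of the degrees of [C] in its two slots, and in the first slot only
    the degree of [C] in its first slot; when it is symmetric under exchange of
    these slots, [C] has degree 0 in its second slot, that is, [C = g ⊗ 1]
    ([symmetric_one_tens]). The same device kills [D] ([left_twist_eq0]), makes [A]
    equal to 0 or to [t] ([idempotent_left_twist]), and finally kills [B]
    ([prelie_equations_solution]). Conversely the associator is trilinear over [H],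
    so the identity may be checked on the basis ([left_prelie_of_type]).

    Degree arguments need leading terms that multiply without cancellation, that is,
    the fact that the graded algebra of [H] is a polynomial ring. It is obtained from
    the coproduct instead of a normal form theorem. Let [x_1, ..., x_d] be a basis of
    the image of the Lie algebra in [H], and let [F] be a linear map from [H] to
    [k[X_1, ..., X_d]] with [F 1 = 0] and [F x_i = X_i]. The convolution power
    [S_n = F^n / n!] is a linear map on [H] that sends a product of [n] elements of
    the Lie algebra to the product of their images and kills shorter products
    ([symbol_exists]); this is where characteristic 0 enters. So [S_n] is a
    multiplicative symbol of degree [n], and it detects everything: replacing each
    monomial of [S_n h] by an ordered product of the [x_i] gives back [h] up to
    shorter products ([symbol_section]). For a tensor one applies [S_n] in one slot
    and linear functionals in the others ([tens_symbol_detects]); the image is a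
    polynomial, and a product of nonzero polynomials is nonzero. The computation on
    which all degree comparisons rest is [symbol_mul_Delta]: the top part of
    [X * Delta h] in the first slot sees only the term [h ⊗ 1] of [Delta h]. *)

(** * Linear spans and separating functionals *)

Definition bundle (k : fieldType) (U V : lmodType k) (f : U -> V)
    (fL : linear f) : {linear U -> V} :=
  HB.pack f (GRing.isLinear.Build k U V *:%R f fL).

Lemma linear_map0 (k : fieldType) (U V : lmodType k) (f : U -> V) :
  linear f -> f 0 = 0.
Proof. by move=> fL; apply: (linear0 (bundle fL)). Qed.

Lemma linear_comp (k : fieldType) (U V W : lmodType k) (f : U -> V) (g : V -> W) :
  linear f -> linear g -> linear (g \o f).
Proof. by move=> fL gL c x y; rewrite /= fL gL. Qed.

Lemma linear_mull (k : fieldType) (A : algType k) (a : A) : linear ( *%R a).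
Proof. by move=> c x y; rewrite mulrDr scalerAr. Qed.

Lemma linear_mulr (k : fieldType) (A : algType k) (a : A) : linear ( *%R^~ a).
Proof. by move=> c x y; rewrite /= mulrDl scalerAl. Qed.

Inductive lspan (k : fieldType) (V : lmodType k) (S : V -> Prop) : V -> Prop :=
| lspan0 : lspan S 0
| lspan_cons c v w : S v -> lspan S w -> lspan S (c *: v + w).

Section LinearSpan.
Variable k : fieldType.
Implicit Type V : lmodType k.

Lemma lspan_gen V (S : V -> Prop) v : S v -> lspan S v.
Proof. by move=> Sv; rewrite -[v]scale1r -[_ *: _]addr0; do ?constructor. Qed.

Lemma lspanD V (S : V -> Prop) v w : lspan S v -> lspan S w -> lspan S (v + w).
Proof.
move=> Sv Sw; elim: Sv => [|c u u' Su _ IH]; first by rewrite add0r.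
by rewrite -addrA; constructor.
Qed.

Lemma lspanZ V (S : V -> Prop) c v : lspan S v -> lspan S (c *: v).
Proof.
elim=> [|d u u' Su _ IH]; first by rewrite scaler0; constructor.
by rewrite scalerDr scalerA; constructor.
Qed.

Lemma lspan_sum V (S : V -> Prop) (I : Type) (r : seq I) (P : pred I) (F : I -> V) :
  (forall i, P i -> lspan S (F i)) -> lspan S (\sum_(i <- r | P i) F i).
Proof.
move=> SF; elim/big_rec: _ => [|i v Pi Sv]; first by constructor.
exact: lspanD (SF i Pi) Sv.
Qed.

Lemma lspan_map (V W : lmodType k) (f : V -> W) (S : V -> Prop) (T : W -> Prop) :
  linear f -> (forall v, S v -> lspan T (f v)) ->
  forall v, lspan S v -> lspan T (f v).
Proof.
move=> fL fST v; elim=> [|c u w Su _ IH].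
  by rewrite (linear_map0 fL); constructor.
by rewrite fL; apply: lspanD (lspanZ c (fST u Su)) IH.
Qed.

Lemma lspan_le V (S : V -> Prop) (T : V -> Prop) :
  (forall v, S v -> lspan T v) -> forall v, lspan S v -> lspan T v.
Proof. by move=> ST v; apply: (@lspan_map _ _ id). Qed.

Lemma lspan_eq (V W : lmodType k) (f g : V -> W) (S : V -> Prop) :
  linear f -> linear g -> (forall v, S v -> f v = g v) ->
  forall v, lspan S v -> f v = g v.
Proof.
move=> fL gL fg v; elim=> [|c u w Su _ IH].
  by rewrite (linear_map0 fL) (linear_map0 gL).
by rewrite fL gL IH fg.
Qed.

Lemma lspan_kernel (V W : lmodType k) (f : V -> W) (S : V -> Prop) :
  linear f -> (forall v, S v -> f v = 0) -> forall v, lspan S v -> f v = 0.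
Proof.
move=> fL; apply: (lspan_eq fL) => c x y; by rewrite scaler0 addr0.
Qed.

(** A maximal subspace that contains [S] and avoids [v] is a hyperplane
    complementary to the line of [v]; the functional is the coordinate along [v]. *)
Lemma separating_functional V (S : V -> Prop) v : ~ lspan S v ->
  exists phi : {linear V -> k^o}, (forall u, S u -> phi u = 0) /\ phi v = 1.
Proof.
move=> nSv.
(* The union of the empty chain is empty, so a subspace is allowed to be empty here,
   and has to contain the span of [S] only if it is not. *)
pose P (W : set V) := [/\ forall c x y, W x -> W y -> W (c *: x + y), ~ W v
  & forall x, W x -> (lspan S `<=` W)%classic].
have [|W [[WL Wv WS] Wmax]] := @Zorn_bigcup V P.
  move=> F FP Ftot; split=> [c x y [X FX Xx] [Y FY Yy]|[X FX Xv]|].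
  - case: (Ftot _ _ FX FY) => XY.
    + by exists Y => //; have [YL _ _] := FP _ FY; apply: YL => //; apply: XY.
    + by exists X => //; have [XL _ _] := FP _ FX; apply: XL => //; apply: XY.
  - by have [_ nXv _] := FP _ FX.
  - move=> x [X FX Xx] u Su; exists X => //.
    by have [_ _ XS] := FP _ FX; apply: (XS x).
have {}WS u : lspan S u -> W u.
  move=> Su; apply: contrapT => nWu; apply: (Wmax (lspan S)); last first.
    split=> [c x y Sx Sy|//|x _ //]; exact: lspanD (lspanZ c Sx) Sy.
  split=> [x Wx|SW]; first by case: nWu; apply: (WS x).
  by apply: nWu; apply: SW.
have W0 : W 0 by apply: WS; constructor.
have WZ c x : W x -> W (c *: x) by move=> Wx; rewrite -[_ *: _]addr0; apply: WL.
have Wsum x : exists c : k, W (x - c *: v).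
  case: (pselect (W x)) => [Wx|nWx]; first by exists 0; rewrite scale0r subr0.
  have : ~ P [set y | exists c, W (y - c *: x)]%classic.
    apply: Wmax; split=> [y Wy|/(_ x) Wx]; first by exists 0; rewrite scale0r subr0.
    by apply/nWx/Wx; exists 1; rewrite scale1r subrr.
  move=> nP; apply: contrapT => nWc; apply: nP; split.
  - move=> c y z [d Wy] [e Wz]; exists (c * d + e).
    have := WL c _ _ Wy Wz.
    by rewrite scalerBr scalerA addrACA -opprD -scalerDl.
  - move=> [c Wc]; have [c0|c0] := eqVneq c 0.
      by apply: Wv; move: Wc; rewrite c0 scale0r subr0.
    apply: nWc; exists c^-1; have := WZ (- c^-1) _ Wc.
    by rewrite scalerBr scalerA mulNr mulVf // scaleN1r opprK addrC scaleNr.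
  - by move=> y _ u Su; exists 0; rewrite scale0r subr0; apply: WS.
have Wu x c d : W (x - c *: v) -> W (x - d *: v) -> c = d.
  move=> Wc Wd; apply/eqP; rewrite -subr_eq0; apply/negP=> /negP cd0; apply: Wv.
  have := WL (-1) _ _ Wc Wd; rewrite scaleN1r opprB addrA subrK.
  rewrite -scalerBl => /(WZ (c - d)^-1).
  by rewrite scalerA mulVf // scale1r.
have [phi phiP] := choice Wsum.
have phiL : linear (phi : V -> k^o).
  move=> c x y; apply: (Wu (c *: x + y)) => //.
  have := WL c _ _ (phiP x) (phiP y).
  by rewrite scalerBr scalerA addrACA -opprD -scalerDl.
exists (bundle phiL); split=> [u Su|] /=.
  by apply: (Wu u) => //; rewrite scale0r subr0; apply/WS/lspan_gen.
by apply: (Wu v) => //; rewrite scale1r subrr.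
Qed.

Lemma linear_separated V (v : V) : (forall phi : {linear V -> k^o}, phi v = 0) -> v = 0.
Proof.
move=> phi0; have [//|v0] := eqVneq v 0.
have [|phi [_ /eqP]] := @separating_functional V (fun=> False) v.
  by move=> v_span; case: v_span v0 => [|c u w []]; rewrite eqxx.
by rewrite phi0 eq_sym oner_eq0.
Qed.
End LinearSpan.

(** * Tensors detected by functionals *)

Section TensorEval.
Variables (k : fieldType).

Lemma tlift_is_linear (A B V : lmodType k) (f : A -> B -> V) :
  (forall b, linear (f^~ b)) -> (forall a, linear (f a)) ->
  kbalanced f /\ linear (tlift f).
Proof.
move=> fl fr.
have fb : kbalanced f.
  split=> [a a' b|a b b'|a s b].
  - exact: (linear_addZ (fl b)).1.
  - exact: (linear_addZ (fr a)).1.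
  - by rewrite (linear_addZ (fl b)).2 (linear_addZ (fr a)).2.
split=> // c x y; rewrite (tliftD fb); congr (_ + _).
elim/tens_ind: x => [a b|x x' IH IH'].
  by rewrite tens_scalel !(tlift_pure fb) (linear_addZ (fl b)).2.
by rewrite scalerDr !(tliftD fb) scalerDr IH IH'.
Qed.

Section Tev.
Variables (A B : lmodType k) (R : comAlgType k).
Variables (phi : {linear A -> R}) (psi : {linear B -> R}).

Definition tens_eval : tens A B -> R := tlift (fun a b => phi a * psi b).

Lemma tens_eval_spec :
  kbalanced (fun a b => phi a * psi b) /\ linear tens_eval.
Proof.
apply: tlift_is_linear => [b|a] c x y.
  by rewrite linearP mulrDl scalerAl.
by rewrite linearP mulrDr scalerAr.
Qed.

Lemma tens_eval_linear : linear tens_eval. Proof. exact: tens_eval_spec.2. Qed.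

Lemma tens_evalE a b : tens_eval (a ⊗ b) = phi a * psi b.
Proof. exact: (tlift_pure tens_eval_spec.1). Qed.

HB.instance Definition _ :=
  GRing.isLinear.Build k (tens A B) R *:%R tens_eval tens_eval_spec.2.
End Tev.

Lemma tens_eq (A B V : lmodType k) (f g : tens A B -> V) :
  linear f -> linear g -> (forall a b, f (a ⊗ b) = g (a ⊗ b)) -> f =1 g.
Proof.
move=> fL gL fg; elim/tens_ind=> // x y fx fy.
by rewrite (linear_addZ fL).1 (linear_addZ gL).1 fx fy.
Qed.

Lemma tens_sum (A B : lmodType k) (X : tens A B) :
  exists s : seq (A * B), X = \sum_(p <- s) p.1 ⊗ p.2.
Proof.
elim/tens_ind: X => [a b|_ _ [s ->] [s' ->]].
  by exists [:: (a, b)]; rewrite big_seq1.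
by exists (s ++ s'); rewrite big_cat.
Qed.

Lemma tpure_eq0 (A B : lmodType k) (phi : {linear B -> k^o}) (a : A) b :
  phi b = 1 -> a ⊗ b = 0 -> a = 0.
Proof.
move=> phib; have [|u|fb fL] := @tlift_is_linear A B A (fun a b => phi b *: a).
- by move=> v c x y; rewrite scalerDr !scalerA mulrC.
- by move=> c x y; rewrite linearP scalerDl scalerA.
move/(congr1 (tlift (fun a b => phi b *: a))).
by rewrite (tlift_pure fb) (linear_map0 fL) phib scale1r.
Qed.

(** When the right factor of a summand is a combination of the right factors of the
    others, the summand can be merged into these by changing left factors only. *)
Lemma tens_absorb (A B : lmodType k) (a : A) (m : B) (l : seq B) s :
  [seq p.2 | p <- s] = l -> lspan (fun u => u \in l) m ->
  exists2 s' : seq (A * B), [seq p.2 | p <- s'] = l &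
    a ⊗ m + \sum_(p <- s) p.1 ⊗ p.2 = \sum_(p <- s') p.1 ⊗ p.2.
Proof.
move=> sl lm; elim: lm s sl => [|c u w ul _ IH] s sl.
  by exists s => //; rewrite -(scale0r (0 : B)) -tens_scaler scale0r add0r.
have [s1 s1l s1E] := IH s sl.
move: ul; rewrite -s1l => /mapP[p ps1 ->].
move: s1E; case/splitPr: ps1 s1l => r1 r2 _ sE.
exists (r1 ++ (c *: a + p.1, p.2) :: r2); first by rewrite !map_cat.
rewrite tpureDr -tens_scaler tens_scalel -addrA sE !big_cat !big_cons /=.
by rewrite tpureDl -addrA addrCA.
Qed.

(** By induction on the number of summands: the first one is absorbed by the others,
    or a functional separates its right factor from theirs, and then its left factor
    vanishes. *)
Lemma tens_separated (R : comAlgType k) (M : lmodType k) (Y : tens R M) :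
  (forall lam : {linear M -> k^o}, tlift (fun a m => lam m *: a) Y = 0) -> Y = 0.
Proof.
have [s ->] := tens_sum Y => {Y}.
have [n] := ubnP (size s); elim: n s => // n IHn [_ _|[a m] s /= sn Y0].
  by rewrite big_nil.
have slice (lam : {linear M -> k^o}) r :
    tlift (fun a m => lam m *: a) (\sum_(p <- r) p.1 ⊗ p.2 : tens R M)
    = \sum_(p <- r) lam p.2 *: p.1.
  have [|c|fb fL] := @tlift_is_linear R M R (fun a m => lam m *: a).
  - by move=> b c x y; rewrite scalerDr !scalerA mulrC.
  - by move=> d x y; rewrite linearP scalerDl scalerA.
  rewrite [LHS](linear_sum (bundle fL)); apply: eq_bigr => p _.
  exact: (tlift_pure fb).
case: (pselect (lspan (fun u => u \in [seq p.2 | p <- s]) m)) => [|nm].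
  move=> /(tens_absorb a (erefl _))[s' s's sE].
  move: Y0; rewrite big_cons /= sE => Y0; apply: IHn => //.
  by rewrite -(size_map snd) s's size_map.
have [lam [lam0 lam1]] := separating_functional nm.
have a0 : a = 0.
  have := Y0 lam; rewrite slice big_cons /= lam1 scale1r big_seq big1 ?addr0 //.
  by move=> p ps; rewrite lam0 ?scale0r // map_f.
rewrite big_cons /= a0; have -> : (0 : R) ⊗ m = 0.
  by rewrite -(scale0r (0 : R)) -tens_scalel scale0r.
rewrite add0r; apply: IHn => // lam'; have := Y0 lam'.
by rewrite !slice big_cons a0 scaler0 add0r.
Qed.
End TensorEval.

(** * The word length filtration of the enveloping algebra *)

Section Words.
Variables (k : fieldType) (L : lieAlgType k).
Local Notation H := (uenv L).
Implicit Types (w : seq L) (h : H).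

Definition word w : H := \prod_(x <- w) uiota x.

Lemma word_nil : word [::] = 1. Proof. exact: big_nil. Qed.
Lemma word_cons x w : word (x :: w) = uiota x * word w.
Proof. exact: big_cons. Qed.
Lemma word_cat v w : word (v ++ w) = word v * word w.
Proof. exact: big_cat. Qed.

(** Words of length less than [n], so that [ufilt 0] is zero and the elements of
    degree [n] are those of [ufilt n.+1] that are not in [ufilt n]. *)
Definition ufilt n : H -> Prop :=
  lspan (fun h => exists2 w, (size w < n)%N & h = word w).

Lemma ufilt_word n w : (size w < n)%N -> ufilt n (word w).
Proof. by move=> wn; apply: lspan_gen; exists w. Qed.

Lemma ufilt_le n m h : (n <= m)%N -> ufilt n h -> ufilt m h.
Proof.
move=> nm; apply: lspan_le => _ [w wn ->]; apply: ufilt_word.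
exact: leq_trans wn nm.
Qed.

Lemma ufilt_iotaM n x h : ufilt n h -> ufilt n.+1 (uiota x * h).
Proof.
elim=> [|c u h' [w wn ->] _ IH]; first by rewrite mulr0; constructor.
rewrite mulrDr -scalerAr -word_cons; apply: lspanD IH.
by apply/lspanZ/ufilt_word.
Qed.

Lemma ufilt_exhaustive h : exists n, ufilt n h.
Proof.
suff: lspan (fun h => exists w, h = word w) h.
  elim=> [|c u h' [w ->] _ [n IH]]; first by exists 0; constructor.
  exists (maxn (size w).+1 n); apply: lspanD; last first.
    by apply: ufilt_le IH; apply: leq_maxr.
  by apply/lspanZ/ufilt_word; apply: leq_maxl.
elim/uenv_ind: h => [x|c|u v IHu IHv|u v IHu IHv].
- by apply: lspan_gen; exists [:: x]; rewrite word_cons word_nil mulr1.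
- by apply/lspanZ/lspan_gen; exists [::]; rewrite word_nil.
- exact: lspanD.
- elim: IHu => [|c _ u' [w ->] _ IH]; first by rewrite mul0r; constructor.
  rewrite mulrDl; apply: lspanD IH; rewrite -scalerAl; apply: lspanZ.
  elim: IHv => [|d _ v' [w' ->] _ IH]; first by rewrite mulr0; constructor.
  rewrite mulrDr; apply: lspanD IH; rewrite -scalerAr; apply: lspanZ.
  by apply: lspan_gen; exists (w ++ w'); rewrite word_cat.
Qed.

(** Each exchange of [x] with a letter [y] costs the word in which the two letters
    are replaced by their bracket, which is shorter by one. *)
Lemma word_move x v w :
  ufilt (size (v ++ x :: w)) (word (v ++ x :: w) - word (x :: v ++ w)).
Proof.
elim: v => [|y v IH] /=; first by rewrite subrr; constructor.
rewrite !word_cons; set a := word (v ++ _) in IH *; set b := word (v ++ w).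
have -> : uiota y * a - uiota x * (uiota y * b)
    = uiota y * (a - word (x :: v ++ w)) + word (lieb y x :: v ++ w).
  by rewrite !word_cons -/b uiota_lie mulrBr mulrBl !mulrA subrKA.
apply: lspanD; first exact: ufilt_iotaM.
by apply: ufilt_word; rewrite /= !size_cat /= addnS ltnS.
Qed.

Lemma word_perm v w : perm_eq v w -> ufilt (size v) (word v - word w).
Proof.
elim: v w => [|x v IH] w.
  by move/perm_size/esym/size0nil => ->; rewrite subrr; constructor.
move=> xvw; have xw : x \in w by rewrite -(perm_mem xvw) mem_head.
case/splitPr: xw xvw => w1 w2.
rewrite -[_ :: w2]cat1s perm_sym perm_catCA /= perm_cons perm_sym => vw.
rewrite -(subrKA (word (x :: w1 ++ w2))); apply: lspanD.
  by rewrite !word_cons -mulrBr /=; apply/ufilt_iotaM/IH.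
have -> : (size v).+1 = size (w1 ++ x :: w2).
  by rewrite size_cat /= (perm_size vw) size_cat addnS.
by rewrite -opprB -scaleN1r; apply/lspanZ/word_move.
Qed.

End Words.

Section Counit.
Variables (k : fieldType) (L : lieAlgType k).

Lemma zero_lie_morph : @lie_morph k L k^o (fun=> 0).
Proof. by split=> [c x y|x y]; rewrite ?scaler0 ?addr0 // mul0r subrr. Qed.

Definition counit : uenv L -> k^o := ulift (fun=> 0 : k^o).
Lemma counit1 : counit 1 = 1. Proof. exact: (ulift1 zero_lie_morph). Qed.
Lemma counit_iota x : counit (uiota x) = 0.
Proof. exact: (ulift_iota zero_lie_morph). Qed.
HB.instance Definition _ := GRing.isLinear.Build k (uenv L) k^o *:%R counit
  (ulift_linear zero_lie_morph).
End Counit.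

(** * Coproducts of words *)

Section CoproductOfWords.
Variables (k : fieldType) (L : lieAlgType k).
Implicit Type w : seq L.

Fixpoint splits (T : Type) (w : seq T) : seq (seq T * seq T) :=
  if w is x :: w' then
    [seq (x :: p.1, p.2) | p <- splits w'] ++ [seq (p.1, x :: p.2) | p <- splits w']
  else [:: ([::], [::])].

Lemma Delta_word w : Delta (word w) = \sum_(p <- splits w) word p.1 ⊗ word p.2.
Proof.
elim: w => [|x w IH]; first by rewrite big_seq1 word_nil Delta1.
rewrite word_cons DeltaM IH Delta_iota mulrDl !mulr_sumr big_cat !big_map.
by congr (_ + _); apply: eq_bigr => p _; rewrite tpureM mul1r word_cons.
Qed.

Lemma splits_size w p : p \in splits w -> (size p.1 + size p.2)%N = size w.
Proof.
elim: w p => [|x w IH] p /=; first by rewrite inE => /eqP->.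
rewrite mem_cat => /orP[] /mapP[q /IH <- ->] //=; by rewrite addnS.
Qed.

(** [word w ⊗ 1] is the only term of the coproduct with a left factor of full
    length, because every other term moves a letter to the right factor. *)
Lemma Delta_word_top n w : (size w < n.+1)%N ->
  lspan (fun X => exists v a, (size v < n)%N /\ X = word v ⊗ a)
    (Delta (word w) - word w ⊗ 1).
Proof.
elim: w n => [|x w IH] n wn.
  by rewrite word_nil Delta1 subrr; constructor.
case: n wn => // n wn; have {IH} := IH n wn.
rewrite word_cons DeltaM Delta_iota mulrDl.
set D := Delta (word w) => Dw.
have -> : (uiota x ⊗ 1) * D + (1 ⊗ uiota x) * D - (uiota x * word w) ⊗ 1
    = (uiota x ⊗ 1) * (D - word w ⊗ 1) + (1 ⊗ uiota x) * (D - word w ⊗ 1)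
      + word w ⊗ uiota x.
  rewrite !mulrBr !tpureM !(mul1r, mulr1).
  by rewrite -!addrA; congr (_ + _); rewrite addNr addr0 addrC.
apply: lspanD; last by apply: lspan_gen; exists w, (uiota x).
elim: Dw => [|c _ Y [v [a [vn ->]]] _ IH].
  by rewrite !mulr0 addr0; constructor.
rewrite !mulrDr -!scalerAr !tpureM !mul1r -word_cons addrACA.
apply: lspanD IH; apply: lspanD; apply: lspanZ; apply: lspan_gen.
  by exists (x :: v), a.
by exists v, (uiota x * a); split=> //; apply: ltnW.
Qed.

End CoproductOfWords.

(** * Symbols *)

Section LengthComponent.
Variables (T : eqType) (R : comNzRingType) (g : T -> R).

(** The component of degree [n] of the multiplicative extension of [g] to words. *)
Fixpoint wprod n (w : seq T) : R :=
  match n, w with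
  | 0, [::] => 1
  | n.+1, x :: w => g x * wprod n w
  | _, _ => 0
  end.

Lemma wprod_size n w : size w != n -> wprod n w = 0.
Proof.
elim: n w => [|n IH] [|x w] //=; rewrite eqSS => wn; by rewrite IH ?mulr0.
Qed.

Lemma wprod_cat m n v w : size v = m -> size w = n ->
  wprod (m + n) (v ++ w) = wprod m v * wprod n w.
Proof.
move=> <- {m}; elim: v => [|x v IH] wn; first by rewrite mul1r.
by rewrite /= IH // mulrA.
Qed.

Lemma wprod_splits0 n w :
  \sum_(p <- splits w) wprod n p.1 * wprod 0 p.2 = wprod n w.
Proof.
elim: w n => [|x w IH] n; first by rewrite big_seq1 mulr1.
rewrite /= big_cat !big_map /= [X in _ + X]big1 ?addr0 => [|p _]; last by rewrite mulr0.
case: n => [|n] /=; first by rewrite big1 // => p _; rewrite mul0r.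
by rewrite -IH mulr_sumr; apply: eq_bigr => p _; rewrite mulrA.
Qed.

(** The terms with a single letter on the right are counted once for each of the
    [n.+1] letters of the word, and all have the same value. *)
Lemma wprod_splits1 n w :
  \sum_(p <- splits w) wprod n p.1 * wprod 1 p.2 = wprod n.+1 w *+ n.+1.
Proof.
elim: w n => [|x w IH] n; first by rewrite big_seq1 mulr0 mul0rn.
have last_x m : \sum_(p <- splits w) wprod m p.1 * wprod 1 (x :: p.2)
    = g x * wprod m w.
  rewrite -wprod_splits0 mulr_sumr; apply: eq_bigr => p _ /=.
  by rewrite mulrCA.
rewrite big_cat !big_map mulrSr; congr (_ + _); last exact: last_x.
case: n => [|n] /=; first by rewrite mulr0n big1 // => p _; rewrite mul0r.
rewrite -mulrnAr -IH mulr_sumr; apply: eq_bigr => p _; by rewrite mulrA.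
Qed.
End LengthComponent.

Section Symbol.
Variables (k : fieldType) (L : lieAlgType k) (R : comAlgType k).
Local Notation H := (uenv L).
Variable F : {linear H -> R}.
Local Notation wp := (wprod (fun x : L => F (uiota x))).

Definition is_symbol n (S : {linear H -> R}) :=
  forall w, (size w <= n)%N -> S (word w) = wp n w.

(** The symbol is the convolution power [F^n / n!], built by
    [S (n.+1) = (S n * F) / n.+1]. As it is defined from the coproduct of [H], its
    values do not depend on how an element is written as a combination of words;
    this replaces the linear independence of ordered monomials. *)
Lemma symbol_exists n : [pchar k] =i pred0 -> F 1 = 0 -> exists S, is_symbol n S.
Proof.
move=> /pcharf0P char0 F1; elim: n => [|n [S SE]].
  have fL : linear (fun h : H => counit h *: (1 : R)).
    by move=> c x y; rewrite linearP scalerDl scalerA.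
  exists (bundle fL) => -[|//] _ /=.
  by rewrite word_nil counit1 scale1r.
have fL : linear (fun h : H => n.+1%:R^-1 *: tens_eval S F (Delta h)).
  move=> c x y; rewrite Delta_linear tens_eval_linear.
  by rewrite scalerDr !scalerA mulrC.
exists (bundle fL) => w wn /=.
rewrite Delta_word linear_sum /=.
rewrite (_ : \sum_(p <- _) _ = wp n.+1 w *+ n.+1); last first.
  (* [F] is only controlled on words of length at most 1; when the right half is
     longer, the left half is shorter than [n] and is killed by [S]. *)
  rewrite -wprod_splits1 big_seq [RHS]big_seq; apply: eq_bigr => -[v u] /splits_size /=.
  rewrite tens_evalE => vu; move: wn; rewrite -vu.
  case: u {vu} => [|x [|y u]] /= wn.
  - by rewrite word_nil F1 !mulr0.
  - by rewrite SE ?word_cons ?word_nil ?mulr1 //; move: wn; rewrite addn1.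
  - have vn : (size v < n)%N by rewrite -ltnS (leq_trans _ wn) // !addnS !ltnS leq_addr.
    rewrite SE 1?ltnW // (@wprod_size _ _ _ n v) ?mul0r //.
    by rewrite neq_ltn vn.
by rewrite -scaler_nat scalerA mulVf ?scale1r // char0.
Qed.

Lemma symbol_lower n S h : is_symbol n S -> ufilt n h -> S h = 0.
Proof.
move=> SE; apply: (lspan_kernel (linearP S)) => _ [w wn ->].
by rewrite SE 1?ltnW // wprod_size // neq_ltn wn.
Qed.
End Symbol.

Definition uspan (k : fieldType) (L : lieAlgType k) d (y : 'I_d -> L) :
  uenv L -> Prop := lspan (fun h => exists i, h = uiota (y i)).

Section GenericFunctional.
Variables (k : fieldType) (L : fdLieAlgType k).
Local Notation H := (uenv L).

(** A spanning family of least size is independent. *)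
Lemma minimal_generators : exists d (y : 'I_d -> L),
  (forall x, uspan y (uiota x)) /\
  (forall i, ~ lspan (fun h => exists2 j, j != i & h = uiota (y j)) (uiota (y i))).
Proof.
pose P d := `[< exists y : 'I_d -> L, forall x, uspan y (uiota x) >].
have /ex_minnP[d /asboolP[y yP] dmin] : exists d, P d.
  exists (\dim {:L}); apply/asboolP.
  exists (fun i => (vbasis {:L})`_i) => x.
  have -> : uiota x = bundle (@uiota_linear _ L) x by [].
  rewrite (coord_vbasis (memvf x)) linear_sum; apply: lspan_sum => i _.
  by rewrite linearZ; apply/lspanZ/lspan_gen; exists i.
exists d, y; split=> // i yi.
case: d y yP dmin i yi => [|d] y yP dmin i yi; first by case: i yi.
suff /dmin : P d by rewrite ltnn.
apply/asboolP; exists (y \o lift i) => x.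
have gen j : j != i -> uspan (y \o lift i) (uiota (y j)).
  rewrite eq_sym => /unlift_some[j' -> _]; apply: lspan_gen; by exists j'.
apply: lspan_le (yP x) => _ [j ->].
have [->|] := eqVneq j i; last exact: gen.
by apply: lspan_le yi => _ [j' j'i ->]; apply: gen.
Qed.

(** [F] takes values in a polynomial ring, so that it specializes to all functionals
    on the image of [L] at once. Subtracting a multiple of the counit, which vanishes
    on [L], makes it vanish at 1. *)
Lemma generic_functional : exists d (y : 'I_d -> L) (F : {linear H -> {mpoly k[d]}}),
  [/\ forall x, uspan y (uiota x), F 1 = 0 & forall i, F (uiota (y i)) = 'X_i].
Proof.
have [d [y [yP yi]]] := minimal_generators.
have [f fP] := choice (fun i => separating_functional (yi i)).
have fL : linear (fun h : H =>
    \sum_i (f i h - counit h * f i 1) *: ('X_i : {mpoly k[d]})).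
  move=> c u v; rewrite scaler_sumr -big_split; apply: eq_bigr => i _.
  rewrite !linearP /= scalerA -scalerDl; congr (_ *: _).
  by rewrite mulrDl mulrBr opprD addrACA mulrA.
exists d, y, (bundle fL); split=> //= [|i].
  by rewrite big1 // => i _; rewrite counit1 mul1r subrr scale0r.
rewrite (bigD1 i) //= counit_iota mul0r subr0 (fP i).2 scale1r.
rewrite big1 ?addr0 // => j ji.
rewrite mul0r subr0 (fP j).1 ?scale0r //.
by exists i; rewrite // eq_sym.
Qed.
End GenericFunctional.

Section SymbolSection.
Variables (k : fieldType) (L : lieAlgType k) (d : nat) (y : 'I_d -> L).
Local Notation H := (uenv L).
Local Notation R := {mpoly k[d]}.
Variable F : {linear H -> R}.
Hypothesis yP : forall x, uspan y (uiota x).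
Hypothesis Fy : forall i, F (uiota (y i)) = 'X_i.

(** The evaluation of polynomials that writes the variables of each monomial in
    increasing order. *)
Definition ordered (p : R) : H := mmap (GRing.in_alg H) (fun i => uiota (y i)) p.

Lemma ordered_is_linear : linear ordered.
Proof.
by move=> c p q; rewrite /ordered mmapD mmapZ /= mulr_algl.
Qed.
HB.instance Definition _ := GRing.isLinear.Build k R H *:%R ordered ordered_is_linear.

Lemma ordered_monomial m : ordered 'X_[m] = word [seq y i | i <- m2s m].
Proof.
rewrite /ordered mmapX /mmap1 /word big_map /m2s big_flatten big_map enumT [index_enum _]unlock.
by apply: eq_bigr => i _; rewrite big_nseq -Monoid.iteropE.
Qed.

Lemma ordered_mulX i m :
  ufilt (mdeg m).+1 (uiota (y i) * ordered 'X_[m] - ordered ('X_i * 'X_[m])).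
Proof.
rewrite -mpolyXD !ordered_monomial -word_cons -(size_m2s m).
rewrite -(size_map y) -/(size (y i :: _)) -map_cons; apply/word_perm/perm_map.
apply/allP => j _ /=.
have E (m' : 'X_{1..d}) : count_mem j (m2s m') = m' j.
  by rewrite -[in RHS](s2mK m') mnmE.
by rewrite !E mnmDE mnm1E.
Qed.

Definition monomials n : R -> Prop := lspan (fun p => exists2 m, mdeg m = n & p = 'X_[m]).

Lemma wprod_monomials w : monomials (size w) (wprod (fun x => F (uiota x)) (size w) w).
Proof.
elim: w => [|x w IH] /=.
  by apply: lspan_gen; exists 0%MM; rewrite ?mdeg0 // mpolyX0.
elim: (yP x) => [|c _ u [i ->] _ IHu]; first by rewrite linear0 mul0r; constructor.
rewrite linearP mulrDl; apply: lspanD IHu; rewrite Fy -scalerAl; apply: lspanZ.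
elim: IH => [|e _ p [m <- ->] _ IHp]; first by rewrite mulr0; constructor.
rewrite mulrDr; apply: lspanD IHp; rewrite -scalerAr; apply: lspanZ.
by apply: lspan_gen; exists (U_(i) + m)%MM; rewrite ?mdegD ?mdeg1 // mpolyXD.
Qed.

Lemma ordered_mulF n x p : monomials n p ->
  ufilt n.+1 (uiota x * ordered p - ordered (F (uiota x) * p)).
Proof.
move=> pn; elim: (yP x) => [|c _ u [i ->] _ IHu].
  by rewrite linear0 !mul0r linear0 subrr; constructor.
rewrite linearP !mulrDl linearD opprD addrACA; apply: lspanD IHu.
rewrite -!scalerAl linearZ -scalerBr Fy; apply: lspanZ.
elim: pn => [|e _ q [m <- ->] _ IHq]; first by rewrite linear0 !mulr0 linear0 subrr; constructor.
rewrite linearP !mulrDr linearD opprD addrACA; apply: lspanD IHq.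
by rewrite -!scalerAr linearZ -scalerBr; apply/lspanZ/ordered_mulX.
Qed.

Lemma ordered_wprod w : ufilt (size w)
  (word w - ordered (wprod (fun x => F (uiota x)) (size w) w)).
Proof.
elim: w => [|x w IH] /=.
  by rewrite -mpolyX0 /ordered mmapX mmap11 word_nil subrr; constructor.
rewrite word_cons -(subrKA (uiota x * ordered (wprod (fun x => F (uiota x)) (size w) w))).
rewrite -mulrBr; apply: lspanD; first exact: ufilt_iotaM.
exact/ordered_mulF/wprod_monomials.
Qed.

(** Modulo shorter words the letters of a word commute, so a word of length [n] agrees
    with the ordered word of the same letters. In particular an element of degree at
    most [n] whose symbol vanishes has smaller degree. *)
Lemma symbol_section n S h : is_symbol F n S -> ufilt n.+1 h ->
  ufilt n (h - ordered (S h)).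
Proof.
move=> SE; have fL : linear (fun h => h - ordered (S h)).
  by move=> c u v; rewrite (linearP S) (linearP ordered) opprD addrACA scalerBr.
apply: (lspan_map fL) => _ [w wn ->].
rewrite SE //; move: wn; rewrite ltnS leq_eqVlt => /predU1P[<-|wn].
  exact: ordered_wprod.
by rewrite wprod_size ?neq_ltn ?wn // linear0 subr0; apply: ufilt_word.
Qed.
End SymbolSection.

(** * Leading terms of tensors *)

Section CoproductLinear.
Variables (k : fieldType) (L : lieAlgType k).
Local Notation H := (uenv L).

Lemma Delta_id_linear : linear (@Delta_id k L).
Proof. by have [] := @Delta_id_alg k L. Qed.
Lemma id_Delta_linear : linear (@id_Delta k L).
Proof. by have [] := @id_Delta_alg k L. Qed.
Lemma perm12_linear : linear (@perm12 k L).
Proof. by have [] := @perm12_alg k L. Qed.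
End CoproductLinear.

Lemma tswapK (k : fieldType) (A B : lmodType k) (X : tens A B) :
  tswap (tswap X) = X.
Proof.
have sL := linear_comp (@tswap_linear k A B) (@tswap_linear k B A).
by apply: (tens_eq sL) X => [//|a b] /=; rewrite !tswap_pure.
Qed.

Section TensorSymbols.
Variables (k : fieldType) (L : lieAlgType k) (d : nat) (y : 'I_d -> L).
Local Notation H := (uenv L).
Local Notation HH := (tens H H).
Local Notation R := {mpoly k[d]}.
Variable F : {linear H -> R}.
Hypothesis yP : forall x, uspan y (uiota x).
Hypothesis Fy : forall i, F (uiota (y i)) = 'X_i.
Variable S : nat -> {linear H -> R}.
Hypothesis SP : forall n, is_symbol F n (S n).

Lemma scalar_linear (M : lmodType k) (lam : {linear M -> k^o}) :
  linear (fun m => lam m *: (1 : R)).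
Proof. by move=> c u v; rewrite linearP scalerDl scalerA. Qed.

Definition scalar_functional (M : lmodType k) (lam : {linear M -> k^o}) :
  {linear M -> R} := bundle (scalar_linear lam).

(** The filtration of [H ⊗ M] by the degree in the first slot. *)
Definition tfilt (M : lmodType k) n : tens H M -> Prop :=
  lspan (fun X => exists w m, (size w < n)%N /\ X = word w ⊗ m).

Lemma tfilt_pure (M : lmodType k) n h (m : M) : ufilt n h -> tfilt n (h ⊗ m).
Proof.
elim=> [|c _ h' [w wn ->] _ IH].
  by rewrite -(scale0r (0 : H)) -tens_scalel scale0r; constructor.
rewrite tpureDl -tens_scalel; apply: lspanD IH; apply/lspanZ/lspan_gen.
by exists w, m.
Qed.

Lemma tfilt_exhaustive (M : lmodType k) (X : tens H M) : exists n, tfilt n X.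
Proof.
elim/tens_ind: X => [h m|X Y [n Xn] [p Yp]].
  by have [n hn] := ufilt_exhaustive h; exists n; apply: tfilt_pure.
exists (maxn n p); apply: lspanD.
  apply: lspan_le Xn => _ [w [m [wn ->]]]; apply: lspan_gen; exists w, m.
  by split=> //; apply: leq_trans wn (leq_maxl _ _).
apply: lspan_le Yp => _ [w [m [wp ->]]]; apply: lspan_gen; exists w, m.
by split=> //; apply: leq_trans wp (leq_maxr _ _).
Qed.

Lemma tfilt1_scalar (M : lmodType k) (X : tens H M) :
  tfilt 1 X -> exists m, X = 1 ⊗ m.
Proof.
elim=> [|c _ Y [[|x w] [m [//= _ ->]]] _ [m' ->]].
  by exists 0; rewrite -(scale0r (0 : M)) -tens_scaler scale0r.
by exists (c *: m + m'); rewrite word_nil tens_scaler -tpureDr.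
Qed.

Lemma least_nonempty (Q : nat -> Prop) :
  ~ Q 0%N -> (exists n, Q n) -> exists2 n, Q n.+1 & ~ Q n.
Proof.
move=> Q0 Qn; have /ex_minnP[[|n] /asboolP Qn1 nmin] : exists n, `[< Q n >].
- by have [n Qn'] := Qn; exists n; apply/asboolP.
- by [].
by exists n => // /asboolP/nmin; rewrite ltnn.
Qed.

Lemma symbol_detects h : h != 0 -> exists2 n, ufilt n.+1 h & S n h != 0.
Proof.
move=> h0; have [|n hn1 hn] := least_nonempty _ (ufilt_exhaustive h).
  by move=> h00; case: h00 h0 => [|? ? ? []//]; rewrite eqxx.
exists n => //; apply/eqP => Sh; apply: hn.
by have := symbol_section yP Fy (@SP n) hn1; rewrite Sh linear0 subr0.
Qed.

(** Take the least [n] for which [X] has degree at most [n] in the first slot. If all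
    functionals on the second slot gave 0, then [S n] would annihilate the first slot
    of [X], and subtracting its ordered lift would not change [X] but lower its
    degree. *)
Lemma tens_symbol_detects (M : lmodType k) (X : tens H M) : X != 0 ->
  exists n (lam : {linear M -> R}), tfilt n.+1 X /\ tens_eval (S n) lam X != 0.
Proof.
move=> X0; have [|n Xn1 Xn] := least_nonempty _ (tfilt_exhaustive X).
  by move=> X00; case: X00 X0 => [|? ? ? [? [? []]]//]; rewrite eqxx.
exists n; apply: contrapT => nlam; apply: Xn.
have idL : linear (@id M) by [].
have SX : tmap (S n) id X = 0.
  apply: tens_separated => lam; apply: contrapT => /eqP sX; apply: nlam.
  exists (scalar_functional lam); split=> //; move: sX; apply: contra_neq => <-.
  have [sb sL] : kbalanced (fun (p : R) m => lam m *: p)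
      /\ linear (tlift (fun (p : R) m => lam m *: p)).
    apply: tlift_is_linear => [m|p] c u v.
      by rewrite scalerDr !scalerA mulrC.
    by rewrite linearP scalerDl scalerA.
  have := linear_comp (tmap_linear (linearP (S n)) idL) sL.
  move=> /(tens_eq (tens_eval_linear (S n) (scalar_functional lam))) -> // h m /=.
  by rewrite (tmap_pure (linearP (S n)) idL) (tlift_pure sb) tens_evalE /= mulr_algr.
pose g (Y : tens H M) : tens H M := Y - tmap (ordered y) id (tmap (S n) id Y).
have gL : linear g.
  move=> c u v; rewrite /g (tmap_linear (linearP (S n)) idL).
  rewrite (tmap_linear (linearP (ordered y)) idL).
  by rewrite opprD addrACA scalerBr.
suff: tfilt n (g X).
  by rewrite /g SX (linear_map0 (tmap_linear (linearP (ordered y)) idL)) subr0.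
apply: (lspan_map gL) Xn1 => _ [w [m [wn ->]]].
rewrite /g !(tmap_pure (linearP _) idL) -[_ - _]/(_ + _) -scaleN1r tens_scalel -tpureDl.
rewrite scaleN1r; apply: tfilt_pure; apply: (symbol_section yP Fy (@SP n)).
exact: ufilt_word.
Qed.

Lemma symbolM p q v w : (size v <= p)%N -> (size w <= q)%N ->
  S (p + q) (word (v ++ w)) = S p (word v) * S q (word w).
Proof.
move=> vp wq; rewrite !SP // ?size_cat ?leq_add //.
have [vE|vN] := eqVneq (size v) p; last first.
  rewrite (wprod_size _ vN) mul0r wprod_size // size_cat.
  by rewrite neq_ltn -addSn leq_add // ltn_neqAle vN.
have [wE|wN] := eqVneq (size w) q; last first.
  rewrite (wprod_size _ wN) mulr0 wprod_size // size_cat.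
  by rewrite neq_ltn -addnS leq_add // ltn_neqAle wN.
exact: wprod_cat.
Qed.

(** All terms of [Delta h] but [h ⊗ 1] have degree less than [q] in the first slot, so
    they do not reach the top degree [p + q]; hence the second slot of [X] is not
    multiplied by anything. *)
Lemma symbol_mul_Delta p q (X : HH) h (lam : {linear H -> R}) :
  tfilt p.+1 X -> ufilt q.+1 h ->
  tens_eval (S (p + q)) lam (X * Delta h) = tens_eval (S p) lam X * S q h.
Proof.
have TL := tens_eval_linear (S (p + q)) lam.
move=> Xp hq.
apply: (lspan_eq (linear_comp (linear_mulr (Delta h)) TL)
  (linear_comp (tens_eval_linear (S p) lam) (linear_mulr (S q h)))) Xp => _ [v [m [vp ->]]] /=.
apply: (lspan_eq (linear_comp (@Delta_linear k L) (linear_comp (linear_mull (word v ⊗ m)) TL))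
  (linear_comp (linearP (S q)) (linear_mull (tens_eval (S p) lam (word v ⊗ m))))) hq.
move=> _ [w wq ->] /=.
rewrite -(subrK (word w ⊗ 1) (Delta (word w))) mulrDr (linear_addZ TL).1.
rewrite tpureM mulr1 !tens_evalE -word_cat symbolM // mulrAC.
rewrite [X in X + _](_ : _ = 0) ?add0r //.
apply: (lspan_kernel (linear_comp (linear_mull (word v ⊗ m)) TL)) (Delta_word_top wq).
move=> _ [u [a [uq ->]]] /=.
rewrite tpureM tens_evalE -word_cat (symbol_lower (@SP (p + q))) ?mul0r //.
by apply: ufilt_word; rewrite size_cat -addnS leq_add.
Qed.

Lemma symbol0_1 : S 0 1 = 1.
Proof. by rewrite -(word_nil L) SP. Qed.

Lemma Delta_mul_eq0 (b g : H) : (b ⊗ 1) * Delta g = 0 -> b = 0 \/ g = 0.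
Proof.
move=> bg; have [->|b0] := eqVneq b 0; first by left.
have [->|g0] := eqVneq g 0; [by right|exfalso].
have [p bp Sb] := symbol_detects b0; have [q gq Sg] := symbol_detects g0.
have := symbol_mul_Delta (S 0) (tfilt_pure 1 bp) gq.
rewrite bg (linear_map0 (tens_eval_linear _ _)) tens_evalE symbol0_1 mulr1 => /esym/eqP.
by rewrite mulf_eq0 (negPf Sb) (negPf Sg).
Qed.

Lemma Delta_eq_scale (b : H) (alpha beta : k) :
  alpha *: Delta b = beta *: (b ⊗ 1) -> b = 0 \/ alpha = beta.
Proof.
have [->|b0 bE] := eqVneq b 0; [by left|right].
have [n bn Sb] := symbol_detects b0.
have one_filt : tfilt 1 (1 : HH).
  by rewrite -[1]/(1 ⊗ 1) -(word_nil L); apply/tfilt_pure/ufilt_word.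
have TZ := (linear_addZ (tens_eval_linear (S n) (S 0))).2.
have := symbol_mul_Delta (S 0) one_filt bn.
rewrite add0n mul1r tens_evalE symbol0_1 !mul1r => DE.
have /(congr1 (tens_eval (S n) (S 0))) := bE; rewrite !TZ DE tens_evalE symbol0_1 mulr1.
move=> /eqP; rewrite -subr_eq0 -scalerBl scaler_eq0 (negPf Sb) orbF subr_eq0.
by move/eqP.
Qed.

Lemma tens_eval3E (f1 f2 f3 : {linear H -> R}) a b c :
  tens_eval (tens_eval f1 f2) f3 (a ⊗ b ⊗ c) = f1 a * f2 b * f3 c.
Proof. by rewrite tens_evalE /= tens_evalE. Qed.

Lemma tens_eval_tassoc (f1 f2 f3 : {linear H -> R}) a (X : HH) :
  tens_eval (tens_eval f1 f2) f3 (tassoc (a ⊗ X)) = f1 a * tens_eval f2 f3 X.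
Proof.
have aL : linear (fun Y : HH => a ⊗ Y : tens H HH).
  by move=> c Y Z; rewrite tpureDr tens_scaler.
have fL := linear_comp (linear_comp aL (@tassoc_linear k H H H))
  (tens_eval_linear (tens_eval f1 f2) f3).
apply: (tens_eq fL (linear_comp (tens_eval_linear f2 f3) (linear_mull (f1 a)))) X => b c /=.
by rewrite tassoc_pure tens_eval3E tens_evalE mulrA.
Qed.

Lemma tens_eval_perm12 (f1 f2 f3 : {linear H -> R}) (X : tens HH H) :
  tens_eval (tens_eval f1 f2) f3 (perm12 X) = tens_eval (tens_eval f2 f1) f3 X.
Proof.
have fL := linear_comp (@perm12_linear k L) (tens_eval_linear (tens_eval f1 f2) f3).
apply: (tens_eq fL (tens_eval_linear (tens_eval f2 f1) f3)) X => ab c.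
have cL : linear (fun Y : HH => Y ⊗ c : tens HH H).
  by move=> e Y Z; rewrite tpureDl tens_scalel.
apply: (tens_eq (linear_comp cL fL) (linear_comp cL (tens_eval_linear _ f3))) ab => a b /=.
by rewrite perm12_pure !tens_eval3E [f1 b * _]mulrC.
Qed.

Lemma one_tens_mul_id_Delta (C : HH) a b :
  one_tens C * id_Delta (a ⊗ b) = tassoc (a ⊗ (C * Delta b)).
Proof.
have [_ _ tM] := @tassoc_alg _ H H H.
by rewrite id_Delta_pure /one_tens -tM tpureM mul1r.
Qed.

Lemma tens_1_mul_Delta_id (C : HH) a b :
  tens_1 C * Delta_id (a ⊗ b) = (C * Delta a) ⊗ b.
Proof. by rewrite Delta_id_pure /tens_1 tpureM mul1r. Qed.

Lemma one_tens_id_Delta_linear (C : HH) : linear (fun X => one_tens C * id_Delta X).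
Proof. exact: (linear_comp (@id_Delta_linear k L) (linear_mull (one_tens C))). Qed.

Lemma tens_1_Delta_id_linear (C : HH) : linear (fun X => tens_1 C * Delta_id X).
Proof. exact: (linear_comp (@Delta_id_linear k L) (linear_mull (tens_1 C))). Qed.

Lemma lower_one_tens n (C X : HH) f2 f3 : tfilt n X ->
  tens_eval (tens_eval (S n) f2) f3 (one_tens C * id_Delta X) = 0.
Proof.
apply: (lspan_kernel (linear_comp (@one_tens_id_Delta_linear C)
  (tens_eval_linear (tens_eval (S n) f2) f3))).
move=> _ [v [m [vn ->]]] /=; rewrite one_tens_mul_id_Delta tens_eval_tassoc.
by rewrite (symbol_lower (@SP n) (ufilt_word vn)) mul0r.
Qed.

Lemma top_one_tens p q (C X : HH) (lam mu : {linear H -> R}) :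
  tfilt p.+1 C -> tfilt q.+1 X ->
  tens_eval (tens_eval mu (S (p + q))) lam (one_tens C * id_Delta (tswap X))
  = tens_eval (S p) lam C * tens_eval (S q) mu X.
Proof.
move=> Cp.
have fL := linear_comp (linear_comp (@tswap_linear k H H) (@one_tens_id_Delta_linear C))
  (tens_eval_linear (tens_eval mu (S (p + q))) lam).
have gL := linear_comp (tens_eval_linear (S q) mu) (linear_mull (tens_eval (S p) lam C)).
apply: (lspan_eq fL gL) => _ [w [m [wq ->]]] /=.
rewrite tswap_pure one_tens_mul_id_Delta tens_eval_tassoc.
by rewrite (symbol_mul_Delta _ Cp (ufilt_word wq)) tens_evalE mulrC mulrA.
Qed.

Lemma top_tens_1 p q (C X : HH) (lam mu : {linear H -> R}) :
  tfilt p.+1 C -> tfilt q.+1 X ->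
  tens_eval (tens_eval (S (p + q)) lam) mu (tens_1 C * Delta_id X)
  = tens_eval (S p) lam C * tens_eval (S q) mu X.
Proof.
move=> Cp.
have fL := linear_comp (@tens_1_Delta_id_linear C)
  (tens_eval_linear (tens_eval (S (p + q)) lam) mu).
have gL := linear_comp (tens_eval_linear (S q) mu) (linear_mull (tens_eval (S p) lam C)).
apply: (lspan_eq fL gL) => _ [w [m [wq ->]]] /=.
rewrite tens_1_mul_Delta_id !tens_evalE /=.
by rewrite (symbol_mul_Delta _ Cp (ufilt_word wq)) mulrA.
Qed.

(** When [e2 ∗ e1 = (g ⊗ 1) ⊗H e1] and [e1 ∗ e2 = X ⊗H e1], this is the coordinate of
    [(e2 ∗ e1) ∗ e2 - e2 ∗ (e1 ∗ e2)] at [e1]. *)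
Definition left_twist (g : H) (X : HH) : tens HH H :=
  tens_1 (g ⊗ 1) * Delta_id X - one_tens X * id_Delta (g ⊗ 1).

Lemma left_twist_pure g a b :
  left_twist g (a ⊗ b) = ((g ⊗ 1) * Delta a) ⊗ b - g ⊗ a ⊗ b.
Proof.
rewrite /left_twist tens_1_mul_Delta_id one_tens_mul_id_Delta Delta1 mulr1.
by rewrite tassoc_pure.
Qed.

Lemma left_twist_linear g : linear (left_twist g).
Proof.
have [oL _ _] := @one_tens_alg k L.
have rL : linear (fun X : HH => one_tens X * id_Delta (g ⊗ 1)).
  exact: (linear_comp oL (linear_mulr (id_Delta (g ⊗ 1)))).
move=> c X Y; rewrite /left_twist (@tens_1_Delta_id_linear (g ⊗ 1)) rL.
by rewrite opprD addrACA scalerBr.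
Qed.

Lemma left_twist_scalar g X : tfilt 1 X -> left_twist g X = 0.
Proof.
by case/tfilt1_scalar=> a ->; rewrite left_twist_pure Delta1 mulr1 subrr.
Qed.

Lemma lower_Delta_right n w f1 a : (size w < n)%N ->
  tens_eval f1 (S n) ((a ⊗ 1) * Delta (word w)) = 0.
Proof.
move=> wn; rewrite Delta_word mulr_sumr linear_sum /= big_seq big1 // => p /splits_size wE.
rewrite tpureM mul1r tens_evalE (symbol_lower (@SP n)) ?mulr0 //; apply: ufilt_word.
by apply: leq_ltn_trans wn; rewrite -wE leq_addl.
Qed.

(** Multiplication by [g] happens in the first slot only, so the second slot of the
    twist has no larger degree than the first slot of [X], whatever [g] is. *)
Lemma lower_left_twist n g (X : HH) f1 f3 : tfilt n X ->
  tens_eval (tens_eval f1 (S n)) f3 (left_twist g X) = 0.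
Proof.
apply: (lspan_kernel (linear_comp (@left_twist_linear g)
  (tens_eval_linear (tens_eval f1 (S n)) f3))).
move=> _ [w [m [wn ->]]] /=.
rewrite left_twist_pure -scaleN1r addrC tens_eval_linear tens_eval3E tens_evalE /=.
rewrite lower_Delta_right // (symbol_lower (@SP n) (ufilt_word wn)).
by rewrite mulr0 !mul0r scaler0 addr0.
Qed.

(** Let [p] and [q] be the degrees of [C] in its two slots. The tensor
    [(1 ⊗ C)(id ⊗ Delta)(C)] has degree [p + q] in the second slot and at most [p] in
    the first, so its symmetry gives [q = 0]. *)
Lemma symmetric_one_tens (C : HH) :
  perm12 (one_tens C * id_Delta C) = one_tens C * id_Delta C ->
  exists g, C = g ⊗ 1.
Proof.
move=> Csym; have [->|C0] := eqVneq C 0.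
  by exists 0; rewrite -(scale0r (0 : H)) -tens_scalel scale0r.
have [p [lam [Cp Clam]]] := tens_symbol_detects C0.
have [|q [mu [Cq Cmu]]] := @tens_symbol_detects _ (tswap C).
  apply: contra_neq C0 => C0.
  by rewrite -(tswapK C) C0 (linear_map0 (@tswap_linear _ _ _)).
case: q Cq Cmu => [|q] Cq Cmu.
  have [g Cg] := tfilt1_scalar Cq; exists g.
  by rewrite -(tswapK C) Cg tswap_pure.
have := top_one_tens lam mu Cp Cq.
rewrite tswapK -Csym tens_eval_perm12 lower_one_tens; last first.
  apply: lspan_le Cp => _ [w [m [wp ->]]]; apply: lspan_gen; exists w, m.
  by split=> //; apply: leq_trans wp _; rewrite addnS ltnS leq_addr.
by move/esym/eqP; rewrite mulf_eq0 (negPf Clam) (negPf Cmu).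
Qed.

Lemma tfilt_double p (X : HH) : (0 < p)%N -> tfilt p.+1 X -> tfilt (p + p) X.
Proof.
move=> p0; apply: lspan_le => _ [w [m [wp ->]]]; apply: lspan_gen; exists w, m.
by split=> //; apply: leq_trans wp _; rewrite -addn1 leq_add2l.
Qed.

(** If [D] has degree [p] in its first slot, then the second slot of the right-hand side
    has degree [2 p], with leading coefficient a square, and that of the left-hand side
    has degree at most [p]. When [p = 0] the left-hand side vanishes. *)
Lemma left_twist_eq0 b (D : HH) :
  left_twist b D = perm12 (tens_1 D * Delta_id D) -> D = 0.
Proof.
have [//|D0] := eqVneq D 0; have [p [lam [Dp Dlam]]] := tens_symbol_detects D0.
move=> /(congr1 (tens_eval (tens_eval lam (S (p + p))) lam)).
rewrite tens_eval_perm12 (top_tens_1 lam lam Dp Dp).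
rewrite (_ : tens_eval _ _ (left_twist b D) = 0); last first.
  case: p Dp {Dlam} => [|p] Dp.
    by rewrite left_twist_scalar // (linear_map0 (tens_eval_linear _ _)).
  exact/lower_left_twist/tfilt_double.
by move/esym/eqP; rewrite mulf_eq0 (negPf Dlam).
Qed.

(** In the first slot [(A ⊗ 1)(Delta ⊗ id)(A)] has twice the degree of [A], and the
    other terms have at most the degree of [A]; so [A = 1 ⊗ a]. The equation then reads
    [1 ⊗ a ⊗ a = t (1 ⊗ Delta a)]. If [a0] is the symbol of [a], then comparing
    leading terms in the second slot gives [a0 ⊗ a = t (a0 ⊗ 1)], so that [a = t]
    unless [a0 = 0]. *)
Lemma idempotent_left_twist t g (A : HH) :
  tens_1 A * Delta_id A - t *: id_Delta A = perm12 (left_twist g A) ->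
  A = 0 \/ A = t *: 1.
Proof.
move=> AE; have [->|A0] := eqVneq A 0; [by left|right].
have [p [lam [Ap Alam]]] := tens_symbol_detects A0.
case: p Ap Alam => [|p] Ap Alam; last first.
  have Ap' : tfilt (p.+1 + p.+1) A by apply: tfilt_double.
  have /(congr1 (tens_eval (tens_eval (S (p.+1 + p.+1)) lam) lam)) := AE.
  rewrite tens_eval_perm12 lower_left_twist // addrC -scaleNr tens_eval_linear.
  rewrite (top_tens_1 lam lam Ap Ap).
  have [_ o1 _] := @one_tens_alg k L.
  have := lower_one_tens 1 lam lam Ap'; rewrite o1 mul1r => ->.
  by rewrite scaler0 add0r => /eqP; rewrite mulf_eq0 (negPf Alam).
have [a Aa] := tfilt1_scalar Ap.
move: AE; rewrite left_twist_scalar // (linear_map0 (@perm12_linear _ _)) Aa.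
move=> /subr0_eq AE.
have a0 : a != 0.
  by apply: contra_neq A0 => a0; rewrite Aa a0 -(scale0r (0 : H)) -tens_scaler scale0r.
have [n an Sn] := symbol_detects a0.
suff -> : a = t *: 1 by rewrite -tens_scaler.
apply/subr0_eq/linear_separated => mu; rewrite linearB linearZ /=.
have /(congr1 (tens_eval (tens_eval (S 0) (S n)) (scalar_functional mu))) := AE.
rewrite tens_1_mul_Delta_id Delta1 mulr1 tens_eval3E id_Delta_pure symbol0_1 mul1r.
rewrite (linear_addZ (tens_eval_linear _ _)).2 tens_eval_tassoc symbol0_1 mul1r.
have one_filt : tfilt 1 (1 : HH).
  by rewrite -[1]/(1 ⊗ 1) -(word_nil L); apply/tfilt_pure/ufilt_word.
have := symbol_mul_Delta (scalar_functional mu) one_filt an.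
rewrite add0n mul1r => ->; rewrite tens_evalE symbol0_1 !mul1r /=.
rewrite -mulrC -scalerAl mul1r -scalerAl mul1r scalerA => /eqP.
by rewrite -subr_eq0 -scalerBl scaler_eq0 (negPf Sn) orbF => /eqP.
Qed.

End TensorSymbols.

(** * Coordinates and associators in a pseudoalgebra of rank two *)

Lemma bcpure0 (H B : nzRingType) (D : H -> B) (A : lmodType H) (a : A) :
  bcpure D 0 a = 0.
Proof. by rewrite -(mul0r 0) -bcpureZ scale0r. Qed.

Section BaseChangeCoordinate.
Variables (H B : nzRingType) (D : H -> B) (A : lmodType H) (c : A -> H).
Hypotheses (DD : {morph D : x y / x + y}) (DM : {morph D : x y / x * y}).
Hypotheses (cD : {morph c : x y / x + y}) (cZ : forall h a, c (h *: a) = h * c a).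

(** The [B]-linear extension of the [H]-linear form [c] to [B ⊗_H A]. *)
Definition bccoord : bchange D A -> B := bclift (fun b a => b * D (c a)).

Lemma bccoord_bal : bcbalanced D (fun b a => b * D (c a)).
Proof.
split=> [b b' a|b a a'|b h a]; first by rewrite mulrDl.
  by rewrite cD DD mulrDr.
by rewrite cZ DM mulrA.
Qed.

Lemma bccoord_pure b a : bccoord (bcpure D b a) = b * D (c a).
Proof. exact: (bclift_pure bccoord_bal). Qed.

Lemma bccoordD : {morph bccoord : x y / x + y}.
Proof. exact: (bcliftD bccoord_bal). Qed.

Lemma bccoordZ b X : bccoord (b *: X) = b * bccoord X.
Proof.
elim/bc_ind: X => [b' a|X Y IHX IHY].
  by rewrite bcpureZ !bccoord_pure mulrA.
by rewrite scalerDr !bccoordD IHX IHY mulrDr.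
Qed.

Lemma bccoordB : {morph bccoord : x y / x - y}.
Proof.
by move=> x y; rewrite -[- y]scaleN1r bccoordD bccoordZ mulN1r.
Qed.
End BaseChangeCoordinate.

Section Coordinates.
Variables (H : nzRingType) (A : lmodType H) (e1 e2 : A).
Hypothesis basis_e : is_basis2 e1 e2.

Lemma basis2_coordinates : exists c1 c2 : A -> H,
  [/\ forall x, x = c1 x *: e1 + c2 x *: e2,
      {morph c1 : x y / x + y} /\ forall h x, c1 (h *: x) = h * c1 x,
      {morph c2 : x y / x + y} /\ forall h x, c2 (h *: x) = h * c2 x,
      c1 e1 = 1 /\ c2 e1 = 0
    & c1 e2 = 0 /\ c2 e2 = 1].
Proof.
have [c cP] := choice (fun x => let: ex_intro u uP := basis_e x in ex_intro _ u uP).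
have uniq x a b : x = a *: e1 + b *: e2 -> c x = (a, b).
  by move=> xE; have [_ cx] := cP x; apply: (cx (a, b)).
have cE x : x = (c x).1 *: e1 + (c x).2 *: e2 by have [] := cP x.
have cD x y : c (x + y) = ((c x).1 + (c y).1, (c x).2 + (c y).2).
  by apply: uniq; rewrite {1}(cE x) {1}(cE y) !scalerDl addrACA.
have cZ h x : c (h *: x) = (h * (c x).1, h * (c x).2).
  by apply: uniq; rewrite {1}(cE x) scalerDr !scalerA.
exists (fun x => (c x).1), (fun x => (c x).2); split=> //.
- by split=> [x y|h x]; rewrite ?cD ?cZ.
- by split=> [x y|h x]; rewrite ?cD ?cZ.
- by rewrite (uniq e1 1 0) // scale1r scale0r addr0.
- by rewrite (uniq e2 0 1) // scale1r scale0r add0r.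
Qed.
End Coordinates.

Section Associator.
Variables (k : fieldType) (L : lieAlgType k) (P : pseudoalgType L).
Local Notation H := (uenv L).
Local Notation HH := (tens H H).
Local Notation A2 := (bchange (@Delta k L) P).
Local Notation A3 := (bchange (@Delta3 k L) P).

Definition associator (x y z : P) : A3 := pprodl (x ∗ y) z - pprodr x (y ∗ z).

Lemma pprodl_scale (h g f : H) (w : A2) (z : P) :
  pprodl ((h ⊗ g) *: w) (f *: z) = (h ⊗ g ⊗ f) *: pprodl w z.
Proof.
have [fD fb] := Delta_id_bal L; have [_ _ fM] := @Delta_id_alg k L.
elim/bc_ind: w => [b x|v w IHv IHw]; last first.
  rewrite (pprodlD z v w) (scalerDr _ (pprodl v z)) -IHv -IHw.
  by rewrite -(pprodlD (f *: z)) -(scalerDr (h ⊗ g) v).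
rewrite bcpureZ !pprodl_pure -[x in x ∗ _]scale1r pprodZ bmapZ // !scalerA.
by rewrite Delta_id_pure Delta1 /tens_1 !tpureM !mulr1 mul1r.
Qed.

Lemma pprodr_scale (h g f : H) (w : A2) (x : P) :
  pprodr (h *: x) ((g ⊗ f) *: w) = (h ⊗ g ⊗ f) *: pprodr x w.
Proof.
have [fD fb] := id_Delta_bal L; have [_ _ fM] := @id_Delta_alg k L.
have [_ _ tM] := @tassoc_alg _ H H H.
elim/bc_ind: w => [b y|v w IHv IHw]; last first.
  rewrite (pprodrD x v w) (scalerDr _ (pprodr x v)) -IHv -IHw.
  by rewrite -(pprodrD (h *: x)) -(scalerDr (g ⊗ f) v).
rewrite bcpureZ !pprodr_pure -[y in _ ∗ y]scale1r pprodZ bmapZ // !scalerA.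
rewrite id_Delta_pure Delta1 /one_tens -tassoc_pure -!tM !tpureM.
by rewrite !mulr1 !mul1r.
Qed.

Lemma pprodl_addr (w : A2) (z z' : P) : pprodl w (z + z') = pprodl w z + pprodl w z'.
Proof.
have [fD fb] := Delta_id_bal L.
elim/bc_ind: w => [b x|v w IHv IHw].
  by rewrite !pprodl_pure pprodDr (bmapD fD fb) scalerDr.
by rewrite (pprodlD (z + z') v) (pprodlD z v) (pprodlD z' v) IHv IHw addrACA.
Qed.

Lemma pprodr_addl (w : A2) (x x' : P) : pprodr (x + x') w = pprodr x w + pprodr x' w.
Proof.
have [fD fb] := id_Delta_bal L.
elim/bc_ind: w => [b y|v w IHv IHw].
  by rewrite !pprodr_pure pprodDl (bmapD fD fb) scalerDr.
by rewrite (pprodrD (x + x') v) (pprodrD x v) (pprodrD x' v) IHv IHw addrACA.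
Qed.

Lemma associatorZ h g f x y z :
  associator (h *: x) (g *: y) (f *: z) = (h ⊗ g ⊗ f) *: associator x y z.
Proof. by rewrite /associator !pprodZ pprodl_scale pprodr_scale scalerBr. Qed.

Lemma associatorD1 x x' y z :
  associator (x + x') y z = associator x y z + associator x' y z.
Proof.
rewrite /associator pprodDl (pprodlD z (x ∗ y)) (pprodr_addl (y ∗ z)) opprD.
by rewrite addrACA.
Qed.

Lemma associatorD2 x y y' z :
  associator x (y + y') z = associator x y z + associator x y' z.
Proof.
rewrite /associator pprodDr pprodDl (pprodlD z (x ∗ y)) (pprodrD x (y ∗ z)) opprD.
by rewrite addrACA.
Qed.

Lemma associatorD3 x y z z' :
  associator x y (z + z') = associator x y z + associator x y z'.
Proof.
rewrite /associator pprodDr (pprodl_addr (x ∗ y)) (pprodrD x (y ∗ z)) opprD.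
by rewrite addrACA.
Qed.

Lemma act12D : {morph @act12 k L P : X Y / X + Y}.
Proof. by have [pD pb] := perm12_bal L; apply: bmapD. Qed.

Lemma act12_0 : act12 0 = 0 :> A3.
Proof. by apply: (addrI (act12 0)); rewrite -act12D !addr0. Qed.

Lemma act12Z (h g f : H) X :
  act12 ((h ⊗ g ⊗ f) *: X) = (g ⊗ h ⊗ f) *: act12 X :> A3.
Proof.
have [pD pb] := perm12_bal L; have [_ _ pM] := @perm12_alg k L.
by rewrite /act12 bmapZ // perm12_pure.
Qed.

Lemma associator_pure x y z u v r (b b' a a' : HH) :
  x ∗ y = b ⊗H u -> u ∗ z = b' ⊗H r -> y ∗ z = a ⊗H v -> x ∗ v = a' ⊗H r ->
  associator x y z
  = bcpure (@Delta3 k L) (tens_1 b * Delta_id b' - one_tens a * id_Delta a') r.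
Proof.
move=> xy uz yz xv; rewrite /associator xy yz pprodl_pure pprodr_pure uz xv.
rewrite bmap_Delta_id bmap_id_Delta !bcpureZ bcpureDl; congr (_ + _).
by rewrite -(mulN1r (one_tens a * _)) -[RHS]bcpureZ scaleN1r.
Qed.

Variables (e1 e2 : P).
Hypothesis basis_e : is_basis2 e1 e2.

(** Both sides are additive in each argument, and they are multiplied by the same
    tensor when the arguments are multiplied by elements of [H]. *)
Lemma left_prelie_on_basis :
  (forall x y z, x \in [:: e1; e2] -> y \in [:: e1; e2] -> z \in [:: e1; e2] ->
     associator x y z = act12 (associator y x z)) -> left_prelie P.
Proof.
move=> pl; pose Q x y z := associator x y z = act12 (associator y x z).
have QZ h g f x y z : Q x y z -> Q (h *: x) (g *: y) (f *: z).
  by rewrite /Q !associatorZ act12Z => ->.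
have QD1 x x' y z : Q x y z -> Q x' y z -> Q (x + x') y z.
  by rewrite /Q associatorD1 associatorD2 act12D => -> ->.
have QD2 x y y' z : Q x y z -> Q x y' z -> Q x (y + y') z.
  by rewrite /Q associatorD1 associatorD2 act12D => -> ->.
have QD3 x y z z' : Q x y z -> Q x y z' -> Q x y (z + z').
  by rewrite /Q !associatorD3 act12D => -> ->.
move=> x y z; change (Q x y z).
have [cx [-> _]] := basis_e x; have [cy [-> _]] := basis_e y; have [cz [-> _]] := basis_e z.
by apply: QD1; apply: QD2; apply: QD3; apply/QZ/pl; rewrite !inE eqxx ?orbT.
Qed.

Section Coordinate.
Variable c : P -> H.
Hypotheses (cD : {morph c : x y / x + y}) (cZ : forall h a, c (h *: a) = h * c a).

Definition coord2 : A2 -> HH := bccoord c.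
Definition coord3 : A3 -> tens HH H := bccoord c.

Lemma Delta3_addM : {morph @Delta3 k L : x y / x + y} * {morph @Delta3 k L : x y / x * y}.
Proof.
have [/linear_addZ[fD _] _ fM] := @Delta3_alg k L; by split.
Qed.

Lemma coord2_pure b x : coord2 (b ⊗H x) = b * Delta (c x).
Proof. exact: (bccoord_pure (@DeltaD k L) (@DeltaM k L) cD cZ). Qed.
Lemma coord2D : {morph coord2 : x y / x + y}.
Proof. exact: (bccoordD (@DeltaD k L) (@DeltaM k L) cD cZ). Qed.
Lemma coord3_pure b x : coord3 (bcpure (@Delta3 k L) b x) = b * Delta3 (c x).
Proof. exact: (bccoord_pure Delta3_addM.1 Delta3_addM.2 cD cZ). Qed.
Lemma coord3D : {morph coord3 : x y / x + y}.
Proof. exact: (bccoordD Delta3_addM.1 Delta3_addM.2 cD cZ). Qed.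
Lemma coord3B : {morph coord3 : x y / x - y}.
Proof. exact: (bccoordB Delta3_addM.1 Delta3_addM.2 cD cZ). Qed.
Lemma coord3Z b X : coord3 (b *: X) = b * coord3 X.
Proof. exact: (bccoordZ Delta3_addM.1 Delta3_addM.2 cD cZ). Qed.

Lemma coord3_Delta_id X : coord3 (bmap (@Delta3 k L) (@Delta_id k L) X) = Delta_id (coord2 X).
Proof.
have [fD fb] := Delta_id_bal L.
elim/bc_ind: X => [b x|X Y IHX IHY]; last by rewrite bmapD // coord3D IHX IHY coord2D fD.
by rewrite bmap_Delta_id coord3_pure coord2_pure fb.
Qed.

Lemma coord3_id_Delta X : coord3 (bmap (@Delta3 k L) (@id_Delta k L) X) = id_Delta (coord2 X).
Proof.
have [fD fb] := id_Delta_bal L.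
elim/bc_ind: X => [b x|X Y IHX IHY]; last by rewrite bmapD // coord3D IHX IHY coord2D fD.
by rewrite bmap_id_Delta coord3_pure coord2_pure fb.
Qed.

Lemma coord3_act12 X : coord3 (act12 X) = perm12 (coord3 X).
Proof.
have [pD pb] := perm12_bal L.
elim/bc_ind: X => [b x|X Y IHX IHY]; last by rewrite act12D !coord3D IHX IHY pD.
by rewrite act12_pure !coord3_pure pb.
Qed.

Lemma coord3_pprodl b x z :
  coord3 (pprodl (b ⊗H x) z) = tens_1 b * Delta_id (coord2 (x ∗ z)).
Proof. by rewrite pprodl_pure coord3Z coord3_Delta_id. Qed.
Lemma coord3_pprodr b x y :
  coord3 (pprodr x (b ⊗H y)) = one_tens b * id_Delta (coord2 (x ∗ y)).
Proof. by rewrite pprodr_pure coord3Z coord3_id_Delta. Qed.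

End Coordinate.
End Associator.

(** An associator of basis vectors has coordinates with four summands, most of which
    vanish or are scalar multiples of one factor. In the application [l], [l'], [r],
    [r'] are [tens_1], [Delta_id], [one_tens], [id_Delta] and [s] is [perm12]; the
    bookkeeping only needs that they are linear, that the first four fix 1, and that
    [s] fixes the image of [l']. *)
Section AssociatorShape.
Variables (k : fieldType) (V T : algType k) (l l' r r' : V -> T) (s : T -> T) (t : k).
Hypotheses (lL : linear l) (l'L : linear l') (rL : linear r) (r'L : linear r').
Hypotheses (sL : linear s) (l1 : l 1 = 1) (l'1 : l' 1 = 1) (r1 : r 1 = 1) (r'1 : r' 1 = 1).
Hypothesis sl' : forall X, s (l' X) = l' X.
Implicit Types X Y Z U A B C D : V.

Definition associator_shape X Y X' Y' Z U Z' U' :=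
  l X * l' Y + l X' * l' Y' - (r Z * r' U + r Z' * r' U').
Local Notation q := associator_shape.

Let zeros := (linear_map0 lL, linear_map0 l'L, linear_map0 rL, linear_map0 r'L,
  linear_map0 sL, mul0r, mulr0, addr0, add0r, subr0, oppr0).
Let scalars := ((linear_addZ lL).2, (linear_addZ l'L).2, (linear_addZ rL).2,
  (linear_addZ r'L).2, l1, l'1, r1, r'1).
Let scale1 c (X : T) : (c *: 1) * X = c *: X.
Proof. by rewrite -scalerAl mul1r. Qed.
Let scaler c (X : T) : X * (c *: 1) = c *: X.
Proof. by rewrite -scalerAr mulr1. Qed.
Let sN (X : T) : s (- X) = - s X.
Proof. by rewrite -scaleN1r (linear_addZ sL).2 scaleN1r. Qed.

Lemma associator_shape_112_2 A B :
  q 0 B 0 (t *: 1) A 0 B B = s (q 0 B 0 (t *: 1) A 0 B B) ->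
  s (r B * r' B) = r B * r' B.
Proof. by rewrite /q !zeros sN => /oppr_inj. Qed.

Lemma associator_shape_221_1 C D :
  q 0 0 (t *: 1) C C C D 0 = s (q 0 0 (t *: 1) C C C D 0) ->
  s (r C * r' C) = r C * r' C.
Proof.
have [sD sZ] := linear_addZ sL.
by rewrite /q !zeros !scalars scale1 sD sZ sl' sN => /addrI/oppr_inj.
Qed.

Lemma associator_shape_121 A B C D X Y Z U :
  q A 0 B X C 0 D Y = s (q C 0 D X 0 Z 0 U) ->
  l B * l' X - r D * r' Y = s (l D * l' X).
Proof. by rewrite /q !zeros. Qed.

Lemma associator_shape_122_1 A B C D :
  q A A B 0 0 0 (t *: 1) A = s (q C A D 0 A C B 0) ->
  l A * l' A - t *: r' A = s (l C * l' A - r A * r' C).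
Proof. by rewrite /q !zeros !scalars scale1. Qed.

Lemma associator_shape_122_2 A B C D :
  q A B B (t *: 1) 0 0 (t *: 1) B = s (q C B D (t *: 1) A D B (t *: 1)) ->
  l A * l' B + t *: l B - t *: r' B
  = s (l C * l' B + t *: l D - (r A * r' D + t *: r B)).
Proof. by rewrite /q !zeros !scalars scale1 !scaler. Qed.
End AssociatorShape.

Section PreLieCoordinates.
Variables (k : fieldType) (L : lieAlgType k) (P : pseudoalgType L).
Variables (e1 e2 : P) (c1 c2 : P -> uenv L).
Local Notation H := (uenv L).
Local Notation HH := (tens H H).
Hypothesis cE : forall x, x = c1 x *: e1 + c2 x *: e2.
Hypotheses (c1D : {morph c1 : x y / x + y}) (c1Z : forall h x, c1 (h *: x) = h * c1 x).
Hypotheses (c2D : {morph c2 : x y / x + y}) (c2Z : forall h x, c2 (h *: x) = h * c2 x).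

Lemma coord2_expand (w : bchange (@Delta k L) P) :
  w = coord2 c1 w ⊗H e1 + coord2 c2 w ⊗H e2.
Proof.
elim/bc_ind: w => [b x|v w IHv IHw].
  by rewrite (coord2_pure c1D c1Z) (coord2_pure c2D c2Z) !bcpure_bal -bcpureDr -cE.
rewrite (coord2D c1D c1Z) (coord2D c2D c2Z) !bcpureDl {1}IHv {1}IHw.
by rewrite addrACA.
Qed.

Lemma coord3_associator (c : P -> H) x y z :
  {morph c : x y / x + y} -> (forall h x, c (h *: x) = h * c x) ->
  coord3 c (associator x y z) =
  associator_shape (@tens_1 k L) (@Delta_id k L) (@one_tens k L) (@id_Delta k L)
    (coord2 c1 (x ∗ y)) (coord2 c (e1 ∗ z)) (coord2 c2 (x ∗ y)) (coord2 c (e2 ∗ z))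
    (coord2 c1 (y ∗ z)) (coord2 c (x ∗ e1)) (coord2 c2 (y ∗ z)) (coord2 c (x ∗ e2)).
Proof.
move=> cD cZ; rewrite /associator (coord3B cD cZ).
rewrite {1}[x ∗ y]coord2_expand {1}[y ∗ z]coord2_expand.
rewrite (pprodlD z (_ ⊗H _)) (pprodrD x (_ ⊗H _)) !(coord3D cD cZ).
by rewrite !(coord3_pprodl cD cZ) !(coord3_pprodr cD cZ).
Qed.

End PreLieCoordinates.

Section ScalarTensors.
Variables (k : fieldType) (L : lieAlgType k).
Local Notation H := (uenv L).
Local Notation HH := (tens H H).

Lemma tens_1_0 : tens_1 (0 : HH) = 0.
Proof. by rewrite /tens_1 -(scale0r (0 : HH)) -tens_scalel scale0r. Qed.
Lemma one_tens_0 : one_tens (0 : HH) = 0.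
Proof. by have [oL _ _] := @one_tens_alg k L; apply: linear_map0. Qed.
Lemma Delta_id_0 : Delta_id (0 : HH) = 0.
Proof. exact: linear_map0 (@Delta_id_linear k L). Qed.
Lemma id_Delta_0 : id_Delta (0 : HH) = 0.
Proof. exact: linear_map0 (@id_Delta_linear k L). Qed.
Lemma perm12_0 : perm12 (0 : tens HH H) = 0.
Proof. exact: linear_map0 (@perm12_linear k L). Qed.
Lemma perm12N (X : tens HH H) : perm12 (- X) = - perm12 X.
Proof. by rewrite -scaleN1r (linear_addZ (@perm12_linear k L)).2 scaleN1r. Qed.

Lemma tens_1_scalar (c : k) : tens_1 (c *: (1 : HH)) = c *: 1.
Proof. by rewrite /tens_1 -tens_scalel. Qed.
Lemma one_tens_scalar (c : k) : one_tens (c *: (1 : HH)) = c *: 1.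
Proof.
have [/linear_addZ[_ oZ] o1 _] := @one_tens_alg k L.
by rewrite oZ o1.
Qed.
Lemma Delta_id_scalar (c : k) : Delta_id (c *: (1 : HH)) = c *: 1.
Proof.
have [/linear_addZ[_ oZ] o1 _] := @Delta_id_alg k L.
by rewrite oZ o1.
Qed.
Lemma id_Delta_scalar (c : k) : id_Delta (c *: (1 : HH)) = c *: 1.
Proof.
have [/linear_addZ[_ oZ] o1 _] := @id_Delta_alg k L.
by rewrite oZ o1.
Qed.

Lemma perm12_Delta_id (X : HH) : perm12 (Delta_id X) = Delta_id X.
Proof.
have fL := linear_comp (@Delta_id_linear k L) (@perm12_linear k L).
apply: (tens_eq fL (@Delta_id_linear k L)) X => a b /=.
by rewrite Delta_id_pure /perm12 tmap_pure ?Delta_cocomm //; apply: tswap_linear.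
Qed.

End ScalarTensors.

(** * The pre-Lie equations of a rank two pseudoalgebra *)

Section PreLieEquations.
Variables (k : fieldType) (L : lieAlgType k).
Local Notation H := (uenv L).
Local Notation HH := (tens H H).
Implicit Types (t : k) (A B C D : HH).

(** For the product [e1 ∗ e2 = A ⊗H e1 + B ⊗H e2],
    [e2 ∗ e1 = C ⊗H e1 + D ⊗H e2], [e1 ∗ e1 = 0], [e2 ∗ e2 = t ⊗H e2], these are
    the coordinates of the left pre-Lie identity from which the four tensors are
    found: [assoc_ijk_l] is the coefficient of [e_l] in the identity at
    [(e_i, e_j, e_k)], without the summands that vanish. *)
Record prelie_equations t A B C D : Prop := PreLieEquations {
  assoc_112_2 : perm12 (one_tens B * id_Delta B) = one_tens B * id_Delta B;
  assoc_221_1 : perm12 (one_tens C * id_Delta C) = one_tens C * id_Delta C;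
  assoc_121_1 : tens_1 B * Delta_id C - one_tens D * id_Delta A
    = perm12 (tens_1 D * Delta_id C);
  assoc_121_2 : tens_1 B * Delta_id D - one_tens D * id_Delta B
    = perm12 (tens_1 D * Delta_id D);
  assoc_122_1 : tens_1 A * Delta_id A - t *: id_Delta A
    = perm12 (tens_1 C * Delta_id A - one_tens A * id_Delta C);
  assoc_122_2 : tens_1 A * Delta_id B + t *: tens_1 B - t *: id_Delta B
    = perm12 (tens_1 C * Delta_id B + t *: tens_1 D
              - (one_tens A * id_Delta D + t *: one_tens B))
}.

Lemma left_prelie_equations (P : pseudoalgType L) (e1 e2 : P) t A B C D :
  is_basis2 e1 e2 ->
  e1 ∗ e1 = 0 -> e2 ∗ e2 = (t *: 1) ⊗H e2 ->
  e1 ∗ e2 = A ⊗H e1 + B ⊗H e2 -> e2 ∗ e1 = C ⊗H e1 + D ⊗H e2 ->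
  left_prelie P -> prelie_equations t A B C D.
Proof.
move=> basis_e e1e1 e2e2 e1e2 e2e1 pl.
have [c1 [c2 [cE [c1D c1Z] [c2D c2Z] [c11 c21] [c12 c22]]]] := basis2_coordinates basis_e.
have Delta0 := linear_map0 (@Delta_linear k L).
have coord1 X Y w : w = X ⊗H e1 + Y ⊗H e2 -> coord2 c1 w = X.
  move=> ->; rewrite (coord2D c1D c1Z) !(coord2_pure c1D c1Z) c11 c12 Delta1 Delta0.
  by rewrite mulr1 mulr0 addr0.
have coord2 X Y w : w = X ⊗H e1 + Y ⊗H e2 -> coord2 c2 w = Y.
  move=> ->; rewrite (coord2D c2D c2Z) !(coord2_pure c2D c2Z) c21 c22 Delta1 Delta0.
  by rewrite mulr1 mulr0 add0r.
have {}e1e1 : e1 ∗ e1 = 0 ⊗H e1 + 0 ⊗H e2 by rewrite !bcpure0 addr0.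
have {}e2e2 : e2 ∗ e2 = 0 ⊗H e1 + (t *: 1) ⊗H e2 by rewrite bcpure0 add0r.
have table := (coord1 _ _ _ e1e1, coord1 _ _ _ e1e2, coord1 _ _ _ e2e1,
  coord1 _ _ _ e2e2, coord2 _ _ _ e1e1, coord2 _ _ _ e1e2, coord2 _ _ _ e2e1,
  coord2 _ _ _ e2e2).
have pl1 x y z : coord3 c1 (associator x y z) = perm12 (coord3 c1 (associator y x z)).
  by rewrite -(coord3_act12 c1D c1Z) [associator x y z]pl.
have pl2 x y z : coord3 c2 (associator x y z) = perm12 (coord3 c2 (associator y x z)).
  by rewrite -(coord3_act12 c2D c2Z) [associator x y z]pl.
have as1 x y z := coord3_associator cE c1D c1Z c2D c2Z x y z c1D c1Z.
have as2 x y z := coord3_associator cE c1D c1Z c2D c2Z x y z c2D c2Z.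
have [lL l1] : linear (@tens_1 k L) /\ tens_1 (1 : HH) = 1.
  by split=> // c X Y; rewrite /tens_1 tpureDl -tens_scalel.
have [l'L l'1 _] := @Delta_id_alg k L.
have [rL r1 _] := @one_tens_alg k L.
have [r'L r'1 _] := @id_Delta_alg k L.
have sL := @perm12_linear k L.
split.
- have := pl2 e1 e1 e2; rewrite as2 !table.
  exact: (associator_shape_112_2 (V := HH) (T := tens HH H) lL r'L sL).
- have := pl1 e2 e2 e1; rewrite as1 !table.
  exact: (associator_shape_221_1 (V := HH) (T := tens HH H) lL r'L sL l1 (@perm12_Delta_id k L)).
- have := pl1 e1 e2 e1; rewrite !as1 !table.
  exact: (associator_shape_121 (V := HH) (T := tens HH H) l'L rL r'L).
- have := pl2 e1 e2 e1; rewrite !as2 !table.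
  exact: (associator_shape_121 (V := HH) (T := tens HH H) l'L rL r'L).
- have := pl1 e1 e2 e2; rewrite !as1 !table.
  exact: (associator_shape_122_1 (V := HH) (T := tens HH H) l'L rL r'L r1).
- have := pl2 e1 e2 e2; rewrite !as2 !table.
  exact: (associator_shape_122_2 (V := HH) (T := tens HH H) l'L rL r'L l'1 r1 r'1).
Qed.

(** The eight associators of basis vectors vanish, except the one at
    [(e2, e2, e1)], whose symmetry is the cocommutativity of the coproduct. *)
Lemma left_prelie_of_type (P : pseudoalgType L) (e1 e2 : P) t (alpha : k) (g : H) :
  is_basis2 e1 e2 ->
  e1 ∗ e1 = 0 -> e2 ∗ e2 = (t *: 1) ⊗H e2 -> alpha = 0 \/ alpha = t ->
  e1 ∗ e2 = (alpha *: 1) ⊗H e1 -> e2 ∗ e1 = (g ⊗ 1) ⊗H e1 -> left_prelie P.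
Proof.
move=> basis_e e1e1_0 e2e2 alphaP e1e2 e2e1.
have e1e1 : e1 ∗ e1 = 0 ⊗H e1 by rewrite e1e1_0 bcpure0.
apply: (left_prelie_on_basis basis_e).
have a111 : associator e1 e1 e1 = 0.
  rewrite (associator_pure e1e1 e1e1 e1e1 e1e1).
  by rewrite tens_1_0 one_tens_0 !mul0r subrr bcpure0.
have a112 : associator e1 e1 e2 = 0.
  rewrite (associator_pure e1e1 e1e2 e1e2 e1e1).
  by rewrite tens_1_0 id_Delta_0 mul0r mulr0 subrr bcpure0.
have a121 : associator e1 e2 e1 = 0.
  rewrite (associator_pure e1e2 e1e1 e2e1 e1e1).
  by rewrite Delta_id_0 id_Delta_0 !mulr0 subrr bcpure0.
have a211 : associator e2 e1 e1 = 0.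
  rewrite (associator_pure e2e1 e1e1 e1e1 e2e1).
  by rewrite Delta_id_0 one_tens_0 mul0r mulr0 subrr bcpure0.
have a122 : associator e1 e2 e2 = 0.
  rewrite (associator_pure e1e2 e1e2 e2e2 e1e2).
  rewrite tens_1_scalar one_tens_scalar Delta_id_scalar id_Delta_scalar.
  rewrite -!scalerAl !mul1r !scalerA -scalerBl.
  by case: alphaP => ->; rewrite ?mulr0 subrr scale0r bcpure0.
have a212 : associator e2 e1 e2 = 0.
  rewrite (associator_pure e2e1 e1e2 e1e2 e2e1).
  rewrite Delta_id_scalar one_tens_scalar -scalerAr -scalerAl mulr1 mul1r.
  by rewrite id_Delta_pure Delta1 (tassoc_pure g 1 1) subrr bcpure0.
have a222 : associator e2 e2 e2 = 0.
  rewrite (associator_pure e2e2 e2e2 e2e2 e2e2).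
  by rewrite tens_1_scalar one_tens_scalar Delta_id_scalar id_Delta_scalar subrr bcpure0.
have a221 : associator e2 e2 e1 = act12 (associator e2 e2 e1).
  have [pD pZ] := linear_addZ (@perm12_linear k L).
  rewrite (associator_pure e2e2 e2e1 e2e1 e2e1) act12_pure; congr bcpure.
  rewrite tens_1_scalar -scalerAl mul1r pD pZ perm12_Delta_id perm12N.
  by rewrite one_tens_mul_id_Delta Delta1 mulr1 tassoc_pure perm12_pure.
move=> x y z; rewrite !inE => /orP[] /eqP -> /orP[] /eqP -> /orP[] /eqP ->;
  by rewrite ?a111 ?a112 ?a121 ?a211 ?a122 ?a212 ?a222 ?act12_0.
Qed.

End PreLieEquations.

(** The order of elimination: symmetry gives [B = b ⊗ 1] and [C = g ⊗ 1]; now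
    [assoc_121_2] has a side of too small degree, so [D = 0]; then [assoc_122_1] leaves
    for [A] the values 0 and [t]. By [assoc_121_1] a nonzero [b] would force [g = 0],
    and [assoc_122_2] would become [A Delta(b) = - t b ⊗ 1] with solution [A = - t],
    which is neither 0 nor [t] in characteristic 0. *)
Lemma prelie_equations_solution (k : fieldType) (L : fdLieAlgType k) t
    (A B C D : tens (uenv L) (uenv L)) :
  [pchar k] =i pred0 -> t != 0 -> prelie_equations t A B C D ->
  exists (alpha : k) (g : uenv L), (alpha = 0 \/ alpha = t) /\
    [/\ A = alpha *: 1, B = 0, C = g ⊗ 1 & D = 0].
Proof.
move=> char0 t0 [eqB eqC eq121_1 eq121_2 eq122_1 eq122_2].
have [d [y [F [yP F1 Fy]]]] := generic_functional L.
have [S SP] := choice (fun n => symbol_exists n char0 F1).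
have [b Bb] := symmetric_one_tens yP Fy SP eqB.
have [g Cg] := symmetric_one_tens yP Fy SP eqC.
rewrite {}Bb {}Cg {eqB eqC} in eq121_1 eq121_2 eq122_1 eq122_2 *.
have D0 : D = 0 := left_twist_eq0 yP Fy SP eq121_2.
rewrite {}D0 {eq121_2} in eq121_1 eq122_2 *.
have [alpha alphaP Aalpha] : exists2 alpha, alpha = 0 \/ alpha = t & A = alpha *: 1.
  case: (idempotent_left_twist yP Fy SP eq122_1) => ->.
    by exists 0; [left|rewrite scale0r].
  by exists t; [right|].
exists alpha, g; split=> //; split=> //.
have g0P : b = 0 \/ g = 0.
  apply: (Delta_mul_eq0 yP Fy SP); apply: (tpure_eq0 (counit1 L)).
  rewrite -tens_1_mul_Delta_id; move: eq121_1.
  by rewrite one_tens_0 tens_1_0 !mul0r subr0 perm12_0.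
suff -> : b = 0 by rewrite -(scale0r (0 : uenv L)) -tens_scalel scale0r.
case: g0P => // g0; have g10 : g ⊗ 1 = 0 :> tens (uenv L) (uenv L).
  by rewrite g0 -(scale0r (0 : uenv L)) -tens_scalel scale0r.
move: eq122_2; rewrite {}g10 {}Aalpha tens_1_0 mul0r id_Delta_0 mulr0 scaler0 !add0r.
rewrite tens_1_scalar -scalerAl mul1r /tens_1 perm12N.
rewrite (linear_addZ (@perm12_linear k L)).2 one_tens_pure perm12_pure.
rewrite id_Delta_pure Delta1 (tassoc_pure b 1 1) Delta_id_pure.
rewrite (addrK (t *: (b ⊗ 1 ⊗ 1))) => bE.
have /(Delta_eq_scale yP Fy SP)[//|alphaN] : alpha *: Delta b = (- t) *: (b ⊗ 1).
  apply/subr0_eq/(tpure_eq0 (counit1 L)).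
  by rewrite -scaleN1r tpureDl -!tens_scalel bE scalerA mulN1r opprK addNr.
move: alphaP; rewrite alphaN => -[/eqP|/eqP]; first by rewrite oppr_eq0 (negPf t0).
rewrite eq_sym -subr_eq0 opprK -mulr2n -mulr_natr mulf_eq0 (negPf t0) /=.
by move/pcharf0P: char0 => ->.
Qed.

Theorem theorem3p10 (k : closedFieldType) (char0 : [pchar k] =i pred0)
    (delta : fdLieAlgType k) (P : pseudoalgType delta) (e1 e2 : P)
    (basis_e : is_basis2 e1 e2) (t : k) (t_neq0 : t != 0)
    (e1e1 : e1 ∗ e1 = 0) (e2e2 : e2 ∗ e2 = (t%:A ⊗ 1) ⊗H e2) :
  left_prelie P <->
  exists (alpha : k) (g : uenv delta),
    [/\ alpha = 0 \/ alpha = t,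
        e1 ∗ e2 = (alpha *: (1 ⊗ 1)) ⊗H e1
      & e2 ∗ e1 = (g ⊗ 1) ⊗H e1].
Proof.
have e2e2' : e2 ∗ e2 = (t *: 1) ⊗H e2 by rewrite e2e2 -tens_scalel.
split=> [pl|[alpha [g [alphaP e1e2 e2e1]]]]; last first.
  exact: (left_prelie_of_type basis_e e1e1 e2e2' alphaP e1e2 e2e1).
have [c1 [c2 [cE [c1D c1Z] [c2D c2Z] _ _]]] := basis2_coordinates basis_e.
have e1e2 := coord2_expand cE c1D c1Z c2D c2Z (e1 ∗ e2).
have e2e1 := coord2_expand cE c1D c1Z c2D c2Z (e2 ∗ e1).
have eqs := left_prelie_equations basis_e e1e1 e2e2' e1e2 e2e1 pl.
have [alpha [g [alphaP [AE B0 CE D0]]]] := prelie_equations_solution char0 t_neq0 eqs.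
exists alpha, g; split=> //.
  by rewrite e1e2 AE B0 bcpure0 addr0.
by rewrite e2e1 CE D0 bcpure0 addr0.
Qed.
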